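(* Let $k$ be an infinite field, let $n\ge 4$ and let $A=\{0=a_0<a_1<\dots<a_{n-1}=d\}\subset\mathbb{N}$ with $\gcd(a_1,\dots,a_{n-1})=1$. Then the Castelnuovo-Mumford regularity of the projective monomial curve $\mathcal{C}_A$ is $$\operatorname{reg}(k[\mathcal{C}_A])=\max\{m(E_{\mathcal{S}}),\,m(\operatorname{AP}_{\mathcal{S}})\}.$$
   Context: $\mathbb{N}=\{0,1,2,\dots\}$. $k[\mathcal{C}_A]=k[x_0,\dots,x_{n-1}]/I(\mathcal{C}_A)$, where $I(\mathcal{C}_A)$ is the kernel of the $k$-algebra homomorphism $k[x_0,\dots,x_{n-1}]\to k[u,v]$, $x_i\mapsto u^{a_i}v^{d-a_i}$; it is standard graded ($\deg x_i=1$) and is the homogeneous coordinate ring of the curve $\mathcal{C}_A\subset\mathbb{P}^{n-1}_k$. If $\beta_{i,j}$ are the graded Betti numbers of $k[\mathcal{C}_A]$ as a graded $k[x_0,\dots,x_{n-1}]$-module, $\operatorname{reg}(k[\mathcal{C}_A])=\max\{j-i:\beta_{i,j}\ne0\}$. Let $\mathbf{a}_i=(a_i,d-a_i)\in\mathbb{N}^2$ for $0\le i\le n-1$ (so $\mathbf{a}_0=(0,d)$, $\mathbf{a}_{n-1}=(d,0)$), and let $\mathcal{S}\subset\mathbb{N}^2$ be the semigroup (with identity) generated by $\mathbf{a}_0,\dots,\mathbf{a}_{n-1}$. Define $\operatorname{AP}_{\mathcal{S}}=\{p\in\mathcal{S}: p-\mathbf{a}_0\notin\mathcal{S},\ p-\mathbf{a}_{n-1}\notin\mathcal{S}\}$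 and $E_{\mathcal{S}}=\{p\in\mathcal{S}: p-\mathbf{a}_0\in\mathcal{S},\ p-\mathbf{a}_{n-1}\in\mathcal{S},\ p-\mathbf{a}_0-\mathbf{a}_{n-1}\notin\mathcal{S}\}$ (both are finite sets). For $s\in\mathbb{N}$ let $L_s=\{(x,y)\in\mathbb{N}^2:x+y=sd\}$, $\operatorname{AP}_s=\operatorname{AP}_{\mathcal{S}}\cap L_s$, $E_s=E_{\mathcal{S}}\cap L_s$. Then $m(E_{\mathcal{S}})=\max\{s\in\mathbb{N}:E_{s+1}\neq\emptyset\}$ (with $m(E_{\mathcal{S}})=-\infty$ if $E_{\mathcal{S}}=\emptyset$) and $m(\operatorname{AP}_{\mathcal{S}})=\max\{s\in\mathbb{N}:\operatorname{AP}_s\neq\emptyset\}$. *)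

(* Defs.v *)
From HB Require Import structures.
From mathcomp Require Import all_boot all_order all_algebra.
From mathcomp Require Import mpoly.

Set Implicit Arguments.
Unset Strict Implicit.
Unset Printing Implicit Defensive.

Import GRing.Theory.
Local Open Scope ring_scope.

Definition infinite_field (k : fieldType) : Prop :=
  forall s : seq k, exists x : k, x \notin s.

(* Maximum of a set of integers, with values in the integers extended by
   [None], which stands for -oo.  An unbounded set has no maximum. *)
Definition is_max (P : int -> Prop) (m : option int) : Prop :=
  match m with
  | Some x => P x /\ (forall y, P y -> y <= x)
  | None => forall y, ~ P y
  end.

Definition emax (x y : option int) : option int :=
  match x, y with
  | Some u, Some v => Some (Num.max u v)
  | Some _, None => x
  | None, _ => y
  end.

(* The library's homogeneity predicate is indexed by [nat]; in negative degrees the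
   homogeneous component of the polynomial ring is zero. *)
Definition homog_of_deg (n : nat) (k : fieldType) (j : int)
    (p : {mpoly k[n]}) : bool :=
  match j with
  | Posz e => p \is e.-homog
  | Negz _ => p == 0
  end.

(* The data of a complex of finitely generated graded free modules over
   [M], written [... -> F_1 -> F_0 -> M].  The [t]-th basis vector of [F_i]
   has degree [res_deg t], so that [F_i] is the direct sum over [t] of the
   [R(- res_deg t)].  Elements of [F_i] are row vectors, and
   [res_map i : F_(i+1) -> F_i] acts by right multiplication. *)
Record free_complex (n : nat) (k : fieldType) (M : lmodType {mpoly k[n]}) :=
  FreeComplex {
    res_rank : nat -> nat;
    res_deg : forall i : nat, 'I_(res_rank i) -> int;
    res_map : forall i : nat, 'M[{mpoly k[n]}]_(res_rank i.+1, res_rank i);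
    res_aug : {linear 'rV[{mpoly k[n]}]_(res_rank 0) -> M}
  }.

(* [gr j x] means that [x] belongs to the degree-[j] component of [M]. *)
Record minimal_graded_resolution (n : nat) (k : fieldType)
    (M : lmodType {mpoly k[n]}) (gr : int -> M -> Prop)
    (F : free_complex M) : Prop := MinimalGradedResolution {
  res_aug_surj : forall x : M, exists v, res_aug F v = x;
  res_exact0 : forall v : 'rV_(res_rank F 0),
    res_aug F v = 0 <-> exists w, v = w *m res_map F 0;
  res_exact : forall (i : nat) (v : 'rV_(res_rank F i.+1)),
    v *m res_map F i = 0 <-> exists w, v = w *m res_map F i.+1;
  res_aug_graded : forall t : 'I_(res_rank F 0),
    gr (res_deg t) (res_aug F (delta_mx 0 t));
  res_map_graded : forall (i : nat) (t : 'I_(res_rank F i.+1))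
      (s : 'I_(res_rank F i)),
    homog_of_deg (res_deg t - res_deg s) (res_map F i t s);
  (* The image of [F_(i+1)] lies in [(x_0, ..., x_(n-1)) F_i]. *)
  res_minimal : forall (i : nat) (t : 'I_(res_rank F i.+1))
      (s : 'I_(res_rank F i)),
    (res_map F i t s)@_0%MM = 0
}.

Definition is_graded_betti (n : nat) (k : fieldType)
    (M : lmodType {mpoly k[n]}) (gr : int -> M -> Prop)
    (beta : nat -> int -> nat) : Prop :=
  exists F : free_complex M, minimal_graded_resolution gr F /\
    forall i j, beta i j = #|[set t : 'I_(res_rank F i) | res_deg t == j]|.

(* Since the minimal graded free resolution is unique up to isomorphism, the
   graded Betti numbers do not depend on a choice; both their existence and
   the independence of the value are part of the requirement. *)
Definition is_regularity (n : nat) (k : fieldType)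
    (M : lmodType {mpoly k[n]}) (gr : int -> M -> Prop)
    (r : option int) : Prop :=
  (exists beta, is_graded_betti gr beta) /\
  (forall beta, is_graded_betti gr beta ->
    is_max (fun z => exists (i : nat) (j : int),
                       beta i j <> 0%N /\ z = j - i%:Z) r).

(* The set [A = {a_0 < ... < a_(n-1)}] is given by a function
   [a : nat -> nat] of which only the values at [i < n] are used. *)

(* [x_i |-> u ^ (a_i) * v ^ (d - a_i)] *)
Definition toric_map (k : fieldType) (n d : nat) (a : nat -> nat)
    (p : {mpoly k[n]}) : {mpoly k[2]} :=
  p \mPo [tuple 'X_ord0 ^+ a i * 'X_ord_max ^+ (d - a i)%N | i < n].

Definition toric_ideal (k : fieldType) (n d : nat) (a : nat -> nat) :
    {pred {mpoly k[n]}} :=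
  fun p => toric_map d a p == 0.

Lemma toric_ideal_closed (k : fieldType) (n d : nat) (a : nat -> nat) :
  idealr_closed (@toric_ideal k n d a).
Proof.
split; rewrite ?unfold_in /toric_map ?comp_mpoly0 ?comp_mpoly1 ?oner_eq0 //.
move=> u x y; rewrite !unfold_in /toric_map => /eqP hx /eqP hy.
by rewrite rmorphD rmorphM /= hx hy mulr0 addr0.
Qed.

HB.instance Definition _ (k : fieldType) (n d : nat) (a : nat -> nat) :=
  isIdealr.Build {mpoly k[n]} (@toric_ideal k n d a)
    (@toric_ideal_closed k n d a).

Definition curve_ring (k : fieldType) (n d : nat) (a : nat -> nat) : Type :=
  {ideal_quot (@toric_ideal k n d a)}.

HB.instance Definition _ (k : fieldType) (n d : nat) (a : nat -> nat) :=
  GRing.ComNzRing.copy (curve_ring k n d a)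
    {ideal_quot (@toric_ideal k n d a)}.

Definition curve_proj (k : fieldType) (n d : nat) (a : nat -> nat)
    (p : {mpoly k[n]}) : curve_ring k n d a :=
  (\pi_({ideal_quot (@toric_ideal k n d a)}) p)%qT.

Definition curve_scale (k : fieldType) (n d : nat) (a : nat -> nat)
    (p : {mpoly k[n]}) (x : curve_ring k n d a) : curve_ring k n d a :=
  curve_proj d a p * x.

Lemma curve_scaleA (k : fieldType) (n d : nat) (a : nat -> nat)
    (p q : {mpoly k[n]}) (x : curve_ring k n d a) :
  curve_scale p (curve_scale q x) = curve_scale (p * q) x.
Proof. by rewrite /curve_scale mulrA /curve_proj -rmorphM. Qed.

Lemma curve_scale1 (k : fieldType) (n d : nat) (a : nat -> nat) :
  left_id 1 (@curve_scale k n d a).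
Proof. by move=> x; rewrite /curve_scale /curve_proj rmorph1 mul1r. Qed.

Lemma curve_scaleDr (k : fieldType) (n d : nat) (a : nat -> nat) :
  right_distributive (@curve_scale k n d a) +%R.
Proof. by move=> p x y; rewrite /curve_scale mulrDr. Qed.

Lemma curve_scaleDl (k : fieldType) (n d : nat) (a : nat -> nat)
    (x : curve_ring k n d a) :
  {morph (@curve_scale k n d a)^~ x : p q / p + q}.
Proof. by move=> p q; rewrite /curve_scale /curve_proj rmorphD mulrDl. Qed.

HB.instance Definition _ (k : fieldType) (n d : nat) (a : nat -> nat) :=
  GRing.Zmodule_isLmodule.Build {mpoly k[n]} (curve_ring k n d a)
    (@curve_scaleA k n d a) (@curve_scale1 k n d a)
    (@curve_scaleDr k n d a) (@curve_scaleDl k n d a).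

Definition curve_gr (k : fieldType) (n d : nat) (a : nat -> nat)
    (j : int) (x : curve_ring k n d a) : Prop :=
  exists p : {mpoly k[n]}, homog_of_deg j p /\ x = curve_proj d a p.

(* Points live in [Z^2], so that the differences below are genuine. *)

Definition avec (d : nat) (a : nat -> nat) (i : nat) : int * int :=
  ((a i)%:Z, (d - a i)%N%:Z).

Definition semigroup (n d : nat) (a : nat -> nat) (p : int * int) : Prop :=
  exists c : 'I_n -> nat, p = \sum_(i < n) avec d a i *+ c i.

Definition AP (n d : nat) (a : nat -> nat) (p : int * int) : Prop :=
  [/\ semigroup n d a p,
      ~ semigroup n d a (p - avec d a 0)
    & ~ semigroup n d a (p - avec d a n.-1)].

Definition Eset (n d : nat) (a : nat -> nat) (p : int * int) : Prop :=
  [/\ semigroup n d a p,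
      semigroup n d a (p - avec d a 0),
      semigroup n d a (p - avec d a n.-1)
    & ~ semigroup n d a (p - avec d a 0 - avec d a n.-1)].

Definition Lline (d s : nat) (p : int * int) : Prop :=
  [/\ 0 <= p.1, 0 <= p.2 & p.1 + p.2 = (s * d)%N%:Z].

Definition is_mAP (n d : nat) (a : nat -> nat) (m : option int) : Prop :=
  is_max (fun z => exists s : nat, z = s%:Z /\
                     exists p, AP n d a p /\ Lline d s p) m.

Definition is_mE (n d : nat) (a : nat -> nat) (m : option int) : Prop :=
  is_max (fun z => exists s : nat, z = s%:Z /\
                     exists p, Eset n d a p /\ Lline d s.+1 p) m.

(* Main.v *)
Require Import Defs.
From HB Require Import structures.
From mathcomp Require Import all_boot all_order all_algebra.
From mathcomp Require Import mpoly ring zify.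
From Stdlib Require Import Classical ClassicalEpsilon.

Set Implicit Arguments.
Unset Strict Implicit.
Unset Printing Implicit Defensive.

Import Order.TTheory GRing.Theory Num.Theory.
Local Open Scope ring_scope.

(** Write [R = k[x_0, ..., x_(n-1)]] and [M] for the coordinate ring of the
    curve.  The proof compares two computations of the numbers [j - i] for
    which the Koszul homology [H_i(xs; M)_j] of a list [xs] of variables is
    nonzero.

    For [xs] the list of all the variables, these are the numbers [j - i] with
    [beta_(i,j)] nonzero, in whatever minimal graded resolution.  Indeed, let
    [0 -> N -> F -> M -> 0] be a step of the resolution.  The Koszul homology of
    the free module [F] vanishes in positive homological degree, and [N] lies
    in [(x_0, ..., x_(n-1)) F] by minimality; the long exact sequence then
    shifts [H_(i+1)(M)] to [H_i(N)] ([kos_acyclic_shift]).  After [i] shifts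
    only [H_0] is left, which counts the basis elements of [F_i]
    ([betti_kos_acyclic]).

    For [xs = x_0, x_(n-1)], the module [M] has a [k]-basis of monomials
    indexed by the semigroup, and everything is read off exponents: [H_0] in
    degree [j] is spanned by the Apery elements of level [j] ([apery_kos]), the
    part of [H_1] in degree [j] by the elements of [E] of level [j]
    ([exceptional_kos]), and [H_2] vanishes since [M] is a domain.  The largest
    [j - i] is therefore the maximum of [m(E)] and [m(AP)].

    Finally, passing from [xs] to [x :: xs] does not change the largest
    [j - i]: the Koszul complex of [x :: xs] is the cone of multiplication by
    [x], which raises the internal degree by one, so a class of largest slope
    is killed by [x] and survives one homological degree higher
    ([is_max_kos_slopes_cons]).

    A minimal resolution by modules of finite rank exists without an appeal to
    the basis theorem.  The bound on the slopes shows that each syzygy module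
    coincides in all large degrees with its product by the ideal of the
    variables, hence that it is generated in bounded degrees; its graded pieces
    are finite-dimensional ([ex_generators]); and a generating family that
    cannot be shortened has no relation with a nonzero constant coefficient
    ([ex_minimal_generators]).

    Only vanishing of homology in given bidegrees is ever used, so homology
    modules are never formed: [kos_acyclic G xs i j] says that every cycle of
    bidegree [(i, j)] is a boundary, and exact sequences become element
    chases. *)

(** * Koszul complexes as iterated cones *)

Lemma eq_pair (T U : Type) (z w : T * U) : z.1 = w.1 -> z.2 = w.2 -> z = w.
Proof. by case: z w => [z1 z2] [w1 w2] /= -> ->. Qed.

Section Koszul.
Variable R : comNzRingType.

(** The underlying module of the Koszul complex [K(xs; V)].  As a cone, the
    complex of [x :: xs] consists of two copies of that of [xs], the second
    one shifted by one both in homological and in internal degree. *)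
Fixpoint kos (V : lmodType R) (xs : seq R) : lmodType R :=
  if xs is _ :: xs' then ((kos V xs' * kos V xs')%type : lmodType R) else V.

Fixpoint kosd (V : lmodType R) (xs : seq R) : kos V xs -> kos V xs :=
  match xs return kos V xs -> kos V xs with
  | [::] => fun=> 0
  | x :: xs' => fun z => (kosd z.1 + x *: z.2, - kosd z.2)
  end.

(** A graded module is given by an ambient module [V] and the family [G] of
    its homogeneous pieces, so that a graded submodule is another family on
    the same [V].  Letting [i] range over the integers makes the shift by one
    in the cone uniform: in negative homological degree only [0] is left. *)
Fixpoint kosdeg (V : lmodType R) (G : int -> V -> Prop) (xs : seq R) :
    int -> int -> kos V xs -> Prop :=
  match xs return int -> int -> kos V xs -> Prop with
  | [::] => fun i j z => if i == 0 then G j z else z = 0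
  | x :: xs' => fun i j z => kosdeg G i j z.1 /\ kosdeg G (i - 1) (j - 1) z.2
  end.

Definition kos_acyclic (V : lmodType R) (G : int -> V -> Prop) (xs : seq R)
    (i j : int) : Prop :=
  forall z : kos V xs, kosdeg G i j z -> kosd z = 0 ->
    exists2 w : kos V xs, kosdeg G (i + 1) j w & kosd w = z.

(** The axioms on the pieces that make [kosd] homogeneous.  No generation
    or direct sum property is imposed. *)
Record graded_family (V : lmodType R) (G : int -> V -> Prop) (xs : seq R) :
    Prop := GradedFamily {
  graded0 : forall j, G j 0;
  gradedB : forall j u v, G j u -> G j v -> G j (u - v);
  gradedM : forall x, x \in xs -> forall j v, G j v -> G (j + 1) (x *: v)
}.

Lemma graded_family_tail (V : lmodType R) (G : int -> V -> Prop) x xs :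
  graded_family G (x :: xs) -> graded_family G xs.
Proof.
by case=> h0 hB hM; split=> // y yxs; apply: hM; rewrite inE yxs orbT.
Qed.

Section Complex.
Variable V : lmodType R.

Lemma kosd_linear xs c (z w : kos V xs) :
  kosd (c *: z + w) = c *: kosd z + kosd w.
Proof.
elim: xs z w => [|x xs IH] z w /=; first by rewrite scaler0 addr0.
apply: eq_pair; rewrite /= !IH.
  by rewrite !scalerDr !scalerA [x * c]mulrC addrACA.
by rewrite opprD scalerN.
Qed.

Lemma kosd0 xs : kosd (0 : kos V xs) = 0.
Proof. by have := kosd_linear (-1) (0 : kos V xs) 0; rewrite scaler0 addr0 scaleN1r addNr. Qed.

Lemma kosdZ xs c (z : kos V xs) : kosd (c *: z) = c *: kosd z.
Proof. by rewrite -[c *: z]addr0 kosd_linear kosd0 addr0. Qed.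

Lemma kosdD xs (z w : kos V xs) : kosd (z + w) = kosd z + kosd w.
Proof. by rewrite -[z in LHS]scale1r kosd_linear scale1r. Qed.

Lemma kosdN xs (z : kos V xs) : kosd (- z) = - kosd z.
Proof. by rewrite -scaleN1r kosdZ scaleN1r. Qed.

Lemma kosdB xs (z w : kos V xs) : kosd (z - w) = kosd z - kosd w.
Proof. by rewrite kosdD kosdN. Qed.

Lemma kosdK xs (z : kos V xs) : kosd (kosd z) = 0.
Proof.
elim: xs z => [|x xs IH] z //=; apply: eq_pair => /=.
  by rewrite kosdD IH kosdZ scalerN add0r subrr.
by rewrite kosdN IH !oppr0.
Qed.

Variable G : int -> V -> Prop.

Lemma kosdeg0 xs i j : graded_family G xs -> kosdeg G i j (0 : kos V xs).
Proof.
elim: xs i j => [|x xs IH] i j hG /=; first by case: eqP => // _; case: hG.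
by split; apply: IH (graded_family_tail hG).
Qed.

Lemma kosdegB xs i j (z w : kos V xs) : graded_family G xs ->
  kosdeg G i j z -> kosdeg G i j w -> kosdeg G i j (z - w).
Proof.
elim: xs i j z w => [|x xs IH] i j z w hG /=.
  case: eqP => [_|_ -> ->]; last by rewrite subr0.
  by case: hG => _ hB _; apply: hB.
by move=> [z1 z2] [w1 w2]; split; apply: IH => //; apply: graded_family_tail hG.
Qed.

Lemma kosdegN xs i j (z : kos V xs) : graded_family G xs ->
  kosdeg G i j z -> kosdeg G i j (- z).
Proof. by move=> hG hz; rewrite -sub0r; apply: kosdegB => //; apply: kosdeg0. Qed.

Lemma kosdegD xs i j (z w : kos V xs) : graded_family G xs ->
  kosdeg G i j z -> kosdeg G i j w -> kosdeg G i j (z + w).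
Proof.
by move=> hG hz hw; rewrite -[w]opprK; apply: kosdegB => //; apply: kosdegN.
Qed.

Lemma kosdegZ xs ys i j (z : kos V xs) x : graded_family G ys -> x \in ys ->
  kosdeg G i j z -> kosdeg G i (j + 1) (x *: z).
Proof.
move=> hG xys; elim: xs i j z => [|y xs IH] i j z /=.
  by case: eqP => [_|_ ->]; [apply: (gradedM hG) | rewrite scaler0].
by move=> [z1 z2]; split; [|rewrite addrAC]; apply: IH.
Qed.

Lemma kosdeg_kosd xs i j (z : kos V xs) : graded_family G xs ->
  kosdeg G i j z -> kosdeg G (i - 1) j (kosd z).
Proof.
elim: xs i j z => [|y xs IH] i j z hG /=.
  by move=> _; case: eqP => // _; case: hG.
have hG' := graded_family_tail hG.
move=> [z1 z2]; split; last by apply: kosdegN => //; apply: IH.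
apply: kosdegD => //; first exact: IH.
by rewrite -[j](subrK 1); apply: (kosdegZ hG); rewrite ?mem_head.
Qed.

Lemma kosdeg_lt0 xs i j (z : kos V xs) : i < 0 -> kosdeg G i j z -> z = 0.
Proof.
elim: xs i j z => [|y xs IH] i j z i0 /=; first by rewrite lt_eqF.
by case: z => z1 z2 /= [h1 h2]; rewrite (IH _ _ _ _ h1) ?(IH _ _ _ _ h2) //; lia.
Qed.

Lemma kosdeg_gt_size xs i j (z : kos V xs) :
  (size xs)%:Z < i -> kosdeg G i j z -> z = 0.
Proof.
elim: xs i j z => [|y xs IH] i j z /= hi; first by case: eqP => // i0; lia.
by case: z => z1 z2 /= [h1 h2]; rewrite (IH _ _ _ _ h1) ?(IH _ _ _ _ h2) //; lia.
Qed.

Lemma kos_acyclic_lt0 xs i j : graded_family G xs -> i < 0 ->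
  kos_acyclic G xs i j.
Proof.
move=> hG i0 z /(kosdeg_lt0 i0)-> _; exists 0; last exact: kosd0.
exact: kosdeg0.
Qed.

Lemma kos_acyclic_gt_size xs i j : graded_family G xs -> (size xs)%:Z < i ->
  kos_acyclic G xs i j.
Proof.
move=> hG hi z /(kosdeg_gt_size hi)-> _; exists 0; last exact: kosd0.
exact: kosdeg0.
Qed.

(** Exactness of [H_i(xs) -> H_i(x :: xs) -> H_(i-1)(xs)(-1)]. *)
Lemma kos_acyclic_cons x xs i j : graded_family G (x :: xs) ->
  kos_acyclic G xs i j -> kos_acyclic G xs (i - 1) (j - 1) ->
  kos_acyclic G (x :: xs) i j.
Proof.
move=> hG h1 h2 [a b] /= [da db] [ab0 /eqP]; rewrite oppr_eq0 => /eqP b0.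
have hG' := graded_family_tail hG.
have [b' db' eb] := h2 b db b0; rewrite subrK in db'.
have [||a' da' ea] := h1 (a + x *: b').
- apply: kosdegD => //; rewrite -[j](subrK 1).
  by apply: (kosdegZ hG); rewrite ?mem_head.
- by rewrite kosdD kosdZ eb ab0.
exists (a', - b') => /=; first by split=> //; rewrite addrK; apply: kosdegN.
by rewrite ea kosdN eb opprK scalerN addrK.
Qed.

(** Exactness of [H_(i+1)(x :: xs) -> H_i(xs)(-1) -> H_i(xs)], where the second
    map is multiplication by [x]: if the outer terms vanish in internal degree
    [j + 1], so does [H_i(xs)_j]. *)
Lemma kos_acyclic_behead x xs i j : graded_family G (x :: xs) ->
  kos_acyclic G (x :: xs) (i + 1) (j + 1) -> kos_acyclic G xs i (j + 1) ->
  kos_acyclic G xs i j.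
Proof.
move=> hG h1 h2 z dz z0; have hG' := graded_family_tail hG.
have [||y dy ey] := h2 (x *: z).
- by apply: (kosdegZ hG); rewrite ?mem_head.
- by rewrite kosdZ z0 scaler0.
have [||[a b] /= [da db] [ea eb]] := h1 (- y, z).
- by split; rewrite /= ?addrK //; apply: kosdegN.
- by rewrite /= kosdN ey addNr z0 oppr0.
exists (- b); last by rewrite kosdN.
by move: db; rewrite !addrK; apply: kosdegN.
Qed.

(** When [xs] lists the variables of a polynomial ring and [G] is a finitely
    generated graded module, the maximum of this set is the
    Castelnuovo-Mumford regularity. *)
Definition kos_slopes (xs : seq R) (z : int) : Prop :=
  exists i j, ~ kos_acyclic G xs i j /\ z = j - i.

(** A nonzero class of largest slope [j - i] is sent by [x] into degree
    [(i, j + 1)], where nothing is left; it comes therefore from a class of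
    [x :: xs] in degree [(i + 1, j + 1)], of the same slope.  No larger slope
    can appear, by [kos_acyclic_cons]. *)
Lemma is_max_kos_slopes_cons x xs m : graded_family G (x :: xs) ->
  is_max (kos_slopes xs) m -> is_max (kos_slopes (x :: xs)) m.
Proof.
move=> hG; case: m => [r|] /=.
  move=> [[i [j [nij er]]] hmax].
  have hle u v : r < v - u -> kos_acyclic G xs u v.
    move=> ruv; apply: NNPP => nuv.
    suff: v - u <= r by rewrite leNgt ruv.
    by apply: hmax; exists u, v.
  split.
    exists (i + 1), (j + 1); split; last by rewrite er; ring.
    by move=> h; apply: nij; apply: kos_acyclic_behead h _ => //; apply: hle; lia.
  move=> _ [u [v [nuv ->]]]; rewrite leNgt; apply/negP => ruv; apply: nuv.
  by apply: kos_acyclic_cons; rewrite //; apply: hle; lia.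
move=> hnone _ [u [v [nuv _]]]; apply: nuv.
have hac p q : kos_acyclic G xs p q.
  by apply: NNPP => npq; apply: (hnone (q - p)); exists p, q.
exact: kos_acyclic_cons.
Qed.

Lemma is_max_kos_slopes_cat ys xs m : graded_family G (ys ++ xs) ->
  is_max (kos_slopes xs) m -> is_max (kos_slopes (ys ++ xs)) m.
Proof.
elim: ys => //= y ys IH hG hm; apply: is_max_kos_slopes_cons => //.
by apply: IH => //; apply: graded_family_tail hG.
Qed.

(** The inclusion of [V] as the component of homological degree [0]. *)
Fixpoint kos_in0 (xs : seq R) (v : V) : kos V xs :=
  match xs return kos V xs with
  | [::] => v
  | x :: xs' => (kos_in0 xs' v, 0)
  end.

(** Homogeneous elements of [xs V], that is, the boundaries of homological degree
    [0]; see [kos_in0_boundaryP]. *)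
Fixpoint lincomb (xs : seq R) (j : int) (v : V) : Prop :=
  if xs is x :: xs' then exists2 b, G (j - 1) b & lincomb xs' j (v - x *: b)
  else v = 0.

Lemma kosd_in0 xs v : kosd (kos_in0 xs v) = 0.
Proof. by elim: xs => [|x xs IH] //=; rewrite IH scaler0 add0r kosd0 oppr0. Qed.

Lemma kosdeg_in0 xs j v : graded_family G xs -> G j v ->
  kosdeg G 0 j (kos_in0 xs v).
Proof.
elim: xs => [|x xs IH] //= hG hv; have hG' := graded_family_tail hG.
by split; [apply: IH | apply: kosdeg0].
Qed.

Lemma kosdeg0P xs j (z : kos V xs) : kosdeg G 0 j z ->
  exists2 v, G j v & z = kos_in0 xs v.
Proof.
elim: xs z => [|x xs IH] /= z; first by exists z.
case: z => a b /= [/IH[v gv ->] /kosdeg_lt0 b0]; exists v => //.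
by rewrite b0 //.
Qed.

Lemma kos_in0B xs u v : kos_in0 xs (u - v) = kos_in0 xs u - kos_in0 xs v.
Proof.
elim: xs => [|x xs IH] //=; rewrite IH; apply: eq_pair => //=.
by rewrite subr0.
Qed.

Lemma kos_in0Z xs c v : kos_in0 xs (c *: v) = c *: kos_in0 xs v.
Proof.
elim: xs => [|x xs IH] //=; rewrite IH; apply: eq_pair => //=.
by rewrite scaler0.
Qed.

Lemma kos_in0_boundaryP xs j v : graded_family G xs ->
  (exists2 w, kosdeg G 1 j w & kosd w = kos_in0 xs v) <-> lincomb xs j v.
Proof.
elim: xs v => [|x xs IH] v hG /=.
  by split=> [[w _ <-] //|->]; exists 0.
have hG' := graded_family_tail hG; split=> [[[w1 w2] /= [d1 d2] [e1 e2]]|].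
  rewrite subrr in d2; have [b gb eb] := kosdeg0P d2.
  exists b => //; apply/IH => //; exists w1 => //.
  by rewrite kos_in0B kos_in0Z -eb -e1 addrK.
move=> [b gb /IH[] // w dw ew]; exists (w, kos_in0 xs b) => /=.
  by split=> //; rewrite subrr; apply: kosdeg_in0.
by rewrite ew kosd_in0 oppr0 kos_in0B kos_in0Z subrK.
Qed.

Lemma kos_acyclic0P xs j : graded_family G xs ->
  kos_acyclic G xs 0 j <-> (forall v, G j v -> lincomb xs j v).
Proof.
move=> hG; split=> [h v gv|h z /kosdeg0P[v gv ->] _].
  apply/(kos_in0_boundaryP _ _ hG).
  by apply: h; [apply: kosdeg_in0 | apply: kosd_in0].
by apply/(kos_in0_boundaryP _ _ hG)/h.
Qed.

Lemma kos_acyclic1_pair x y j :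
  kos_acyclic G [:: x; y] 1 j <->
  (forall u v, G (j - 1) u -> G (j - 1) v -> x *: u + y *: v = 0 ->
    exists2 w, G (j - 1 - 1) w & u = - (y *: w) /\ v = x *: w).
Proof.
split=> [h u v gu gv uv0|h [[p v] [u w]]].
  have [||[[p' v'] [u' w]]] := h ((0, v), (u, 0)) => //=.
    by apply: eq_pair; apply: eq_pair; rewrite /= ?scaler0 !(add0r, oppr0) // addrC.
  move=> [[_ ->] [-> gw]] e; exists w => //.
  move: (congr1 (fun z => z.1.2) e) (congr1 (fun z => z.2.1) e) => /= <- <-.
  by rewrite oppr0 !add0r.
move=> /= [[-> gv] [gu ->]] e.
move: (congr1 (fun z => z.1.1) e) => /=; rewrite add0r addrC => uv0.
have [t gt [-> ->]] := h u v gu gv uv0.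
exists ((0, 0), (0, t)) => //=.
by apply: eq_pair; apply: eq_pair; rewrite /= ?scaler0 !(add0r, oppr0).
Qed.

Lemma kos_acyclic2_pair x y j :
  (forall w : V, x *: w = 0 -> w = 0) -> kos_acyclic G [:: x; y] 2 j.
Proof.
move=> hx [[p v] [u w]] /= [[-> ->] [-> gw]] e.
move: (congr1 (fun z => z.1.2) e) => /=; rewrite oppr0 add0r => /hx ->.
exists ((0, 0), (0, 0)) => //=.
by apply: eq_pair; apply: eq_pair; rewrite /= ?scaler0 !(add0r, oppr0).
Qed.

End Complex.
End Koszul.

(** * Dimension shifting *)

Section KoszulMap.
Variables (R : comNzRingType) (V W : lmodType R) (phi : {linear V -> W}).

Fixpoint kosmap (xs : seq R) : kos V xs -> kos W xs :=
  match xs return kos V xs -> kos W xs with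
  | [::] => phi
  | x :: xs' => fun z => (kosmap z.1, kosmap z.2)
  end.

Lemma kosmap_linear xs c (z w : kos V xs) :
  kosmap (c *: z + w) = c *: kosmap z + kosmap w.
Proof.
by elim: xs z w => [|x xs IH] z w /=; [rewrite linearP | rewrite !IH].
Qed.

Lemma kosmapB xs (z w : kos V xs) : kosmap (z - w) = kosmap z - kosmap w.
Proof. by rewrite addrC -scaleN1r kosmap_linear scaleN1r addrC. Qed.

Lemma kosmap0 xs : kosmap (0 : kos V xs) = 0.
Proof. by rewrite -(subrr 0) kosmapB subrr. Qed.

Lemma kosmap_kosd xs (z : kos V xs) : kosmap (kosd z) = kosd (kosmap z).
Proof.
elim: xs z => [|x xs IH] z /=; first by rewrite linear0.
rewrite addrC kosmap_linear !IH addrC; apply: eq_pair => //=.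
by rewrite -[- kosd z.2]sub0r kosmapB kosmap0 IH sub0r.
Qed.

Variables (GV : int -> V -> Prop) (GW : int -> W -> Prop) (xs : seq R).
Let GK (j : int) (v : V) : Prop := GV j v /\ phi v = 0.

Lemma kosdeg_ker ys i j (z : kos V ys) :
  kosdeg GV i j z -> kosmap z = 0 -> kosdeg GK i j z.
Proof.
elim: ys i j z => [|y ys IH] i j z /=; first by case: eqP.
by move=> [d1 d2] [e1 e2]; split; apply: IH.
Qed.

Lemma kosdeg_sub ys i j (z : kos V ys) :
  kosdeg GK i j z -> kosdeg GV i j z /\ kosmap z = 0.
Proof.
elim: ys i j z => [|y ys IH] i j z /=.
  by case: eqP => // _ ->; rewrite linear0.
by move=> [/IH[d1 e1] /IH[d2 e2]]; rewrite e1 e2.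
Qed.

Hypothesis gV : graded_family GV xs.
Hypothesis phi_onto : forall j w, GW j w -> exists2 v, GV j v & phi v = w.
Hypothesis phi_graded : forall j v, GV j v -> GW j (phi v).

Lemma kosmap_lift ys i j (w : kos W ys) :
  kosdeg GW i j w -> exists2 v, kosdeg GV i j v & kosmap v = w.
Proof.
elim: ys i j w => [|y ys IH] i j w /=.
  by case: eqP => [_|_ ->]; [apply: phi_onto | exists 0; rewrite ?linear0].
case: w => w1 w2 /= [/IH[v1 d1 <-] /IH[v2 d2 <-]].
by exists (v1, v2).
Qed.

Lemma kosdeg_kosmap ys i j (v : kos V ys) :
  kosdeg GV i j v -> kosdeg GW i j (kosmap v).
Proof.
elim: ys i j v => [|y ys IH] i j v /=.
  by case: eqP => [_|_ ->]; [apply: phi_graded | rewrite linear0].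
by move=> [d1 d2]; split; apply: IH.
Qed.

(* [V] stands for a free module covering [W], and [ker_min] for minimality of
   the cover. *)
Hypothesis V_acyclic : forall i j, 1 <= i -> kos_acyclic GV xs i j.
Hypothesis ker_min : forall j v, GV j v -> phi v = 0 -> lincomb GV xs j v.

(** The cycles of the kernel bound in [V]: for [i >= 1] because [V] is acyclic,
    for [i = 0] because the kernel lies in [xs V]. *)
Lemma ker_cycle_boundary i j (z : kos V xs) : 0 <= i -> kosdeg GK i j z ->
  kosd z = 0 -> exists2 w, kosdeg GV (i + 1) j w & kosd w = z.
Proof.
move=> i0 dz z0; have [ei|i1] := eqVneq i 0.
  rewrite {}ei in dz *; have [v [gv v0] ->] := kosdeg0P dz; rewrite add0r.
  exact/(kos_in0_boundaryP _ _ gV)/ker_min.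
by have [dz' _] := kosdeg_sub dz; apply: V_acyclic => //; lia.
Qed.

(** The connecting map [H_(i+1)(W) -> H_i(ker phi)] is an isomorphism; for
    [i = 0] this uses that [H_0(ker phi) -> H_0(V)] is zero. *)
Lemma kos_acyclic_shift i j : 0 <= i ->
  kos_acyclic GW xs (i + 1) j <-> kos_acyclic GK xs i j.
Proof.
move=> i0; split=> h z dz z0.
  have [w dw ew] := ker_cycle_boundary i0 dz z0.
  have [_ mz] := kosdeg_sub dz.
  have [||u du eu] := h (kosmap w); first exact: kosdeg_kosmap.
    by rewrite -kosmap_kosd ew.
  have [u' du' eu'] := kosmap_lift du.
  exists (w - kosd u'); last by rewrite kosdB kosdK subr0.
  apply: kosdeg_ker; last by rewrite kosmapB kosmap_kosd eu' eu subrr.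
  by apply: kosdegB => //; rewrite -[i + 1](addrK 1); apply: kosdeg_kosd.
have [y dy ey] := kosmap_lift dz.
have dky : kosdeg GK i j (kosd y).
  apply: kosdeg_ker; last by rewrite kosmap_kosd ey.
  by rewrite -[i](addrK 1); apply: kosdeg_kosd.
have [v /kosdeg_sub[dv v0] ev] := h _ dky (kosdK y).
have [|||w dw ew] := V_acyclic (i := i + 1) (j := j) _ (z := y - v).
- by lia.
- exact: kosdegB.
- by rewrite kosdB ev subrr.
exists (kosmap w); first exact: kosdeg_kosmap.
by rewrite -kosmap_kosd ew kosmapB ey v0 subr0.
Qed.

Lemma kos_acyclic0_shift j :
  kos_acyclic GW xs 0 j <-> kos_acyclic GV xs 0 j.
Proof.
split=> h z dz z0.
  have [||u du eu] := h (kosmap z); first exact: kosdeg_kosmap.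
    by rewrite -kosmap_kosd z0 kosmap0.
  have [u' du' eu'] := kosmap_lift du.
  have dd : kosdeg GV 0 j (kosd u') by rewrite -[0](addrK 1); apply: kosdeg_kosd.
  have [||w dw ew] := ker_cycle_boundary (lexx 0) (j := j) (z := z - kosd u').
  - apply: kosdeg_ker; first exact: kosdegB.
    by rewrite kosmapB kosmap_kosd eu' eu subrr.
  - by rewrite kosdB z0 kosdK subrr.
  by exists (w + u'); [apply: kosdegD | rewrite kosdD ew subrK].
have [y dy ey] := kosmap_lift dz.
have [|w dw ew] := h y dy.
  have [v gv ->] := kosdeg0P dy; exact: kosd_in0.
by exists (kosmap w); [apply: kosdeg_kosmap | rewrite -kosmap_kosd ew].
Qed.

End KoszulMap.

(** * Polynomials, homogeneous components and free modules *)

Section MonomialTools.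
Variables (k : fieldType) (n : nat).
Implicit Types (p q : {mpoly k[n]}) (m w : 'X_{1..n}) (j : int) (i : 'I_n).

Lemma mcoeffXM w q m :
  ('X_[w] * q)@_m = if (w <= m)%MM then q@_(m - w)%MM else 0.
Proof.
rewrite mulrC; case: ifPn => [wm|nwm]; first by rewrite -[in LHS](submK wm) addmC mcoeffMX.
apply: memN_msupp_eq0; rewrite (perm_mem (msuppMX q w)).
by apply: contra nwm => /mapP[m' _ ->]; apply: lem_addr.
Qed.

Lemma mnm1_le i m : (U_(i) <= m)%MM = (m i != 0%N).
Proof.
apply/mnm_lepP/idP => [/(_ i)|mi t]; first by rewrite mnm1E eqxx lt0n.
by rewrite mnm1E; case: eqP => [<-|//]; rewrite lt0n.
Qed.

Lemma homog_of_degP j p :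
  homog_of_deg j p <-> (forall m, p@_m != 0 -> (mdeg m)%:Z = j).
Proof.
case: j => e /=; last first.
  split=> [/eqP-> m|h]; first by rewrite mcoeff0 eqxx.
  by apply/eqP/mpolyP => m; rewrite mcoeff0; apply/eqP/contraT => /h; lia.
split=> [/dhomogP h m|h]; first by rewrite -mcoeff_msupp => /h ->.
by apply/dhomogP => m; rewrite mcoeff_msupp => /h [].
Qed.

(** Homogeneous components indexed by the integers, so that the degree shifts of
    free modules need no case distinction. *)
Definition hcomp j p : {mpoly k[n]} :=
  if j is Posz e then pihomog mdeg e p else 0.

Lemma mcoeff_hcomp j p m :
  (hcomp j p)@_m = if (mdeg m)%:Z == j then p@_m else 0.
Proof.
case: j => e /=; rewrite ?mcoeff0 ?eqz_nat //.
elim/mpolyind: p => [|c m' p _ _ IH]; first by rewrite linear0 !mcoeff0 if_same.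
rewrite linearP /= pihomogX !mcoeffD !mcoeffZ IH.
rewrite (fun_if (mcoeff m)) mcoeff0 mcoeffX.
have [->|] := eqVneq m' m; first by case: ifP; rewrite ?mulr0 ?addr0.
by move=> _; rewrite if_same !mulr0 !add0r.
Qed.

Lemma hcomp_homog j p : homog_of_deg j (hcomp j p).
Proof.
apply/homog_of_degP => m; rewrite mcoeff_hcomp.
by case: ifP => [/eqP//|_]; rewrite eqxx.
Qed.

Lemma hcomp_id j p : homog_of_deg j p -> hcomp j p = p.
Proof.
move/homog_of_degP => h; apply/mpolyP => m; rewrite mcoeff_hcomp.
case: ifP => // hm; apply/esym/eqP/contraT => /h/eqP.
by rewrite hm.
Qed.

Lemma hcomp_linear j c p q : hcomp j (c *: p + q) = c *: hcomp j p + hcomp j q.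
Proof.
apply/mpolyP => m; rewrite !(mcoeffD, mcoeffZ, mcoeff_hcomp).
by case: ifP; rewrite ?mulr0 ?addr0.
Qed.

Lemma hcomp0 j : hcomp j 0 = 0.
Proof. by case: j => e //=; rewrite linear0. Qed.

Lemma hcomp_sum j (I : Type) (r : seq I) (P : pred I) (F : I -> {mpoly k[n]}) :
  hcomp j (\sum_(x <- r | P x) F x) = \sum_(x <- r | P x) hcomp j (F x).
Proof.
apply: (big_morph (hcomp j)) => [p q|]; last exact: hcomp0.
by rewrite -[p]scale1r hcomp_linear !scale1r.
Qed.

Lemma homog_of_deg0 j : homog_of_deg j (0 : {mpoly k[n]}).
Proof. by apply/homog_of_degP => m; rewrite mcoeff0 eqxx. Qed.

Lemma homog_of_degB j p q :
  homog_of_deg j p -> homog_of_deg j q -> homog_of_deg j (p - q).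
Proof.
move=> /homog_of_degP hp /homog_of_degP hq; apply/homog_of_degP => m.
rewrite mcoeffB; have [->|/hp//] := eqVneq p@_m 0.
by rewrite sub0r oppr_eq0 => /hq.
Qed.

Lemma homog_of_degM (i j : int) p q :
  homog_of_deg i p -> homog_of_deg j q -> homog_of_deg (i + j) (p * q).
Proof.
case: i => [i|i] hp; last by move/eqP: hp => -> _; rewrite mul0r homog_of_deg0.
case: j => [j|j] hq; last by move/eqP: hq => ->; rewrite mulr0 homog_of_deg0.
exact: dhomogM.
Qed.

Lemma homog_of_degX i : homog_of_deg 1 ('X_i : {mpoly k[n]}).
Proof.
apply/homog_of_degP => m; rewrite mcoeffX.
by have [<- _|_] := eqVneq U_(i)%MM m; rewrite ?mdeg1 // eqxx.
Qed.

Lemma homog_mcoeff0 j p : homog_of_deg j p -> j != 0 -> p@_0%MM = 0.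
Proof.
by move=> /homog_of_degP h; apply: contraNeq => /h <-; rewrite mdeg0.
Qed.

(** The sum of the components over any window of degrees that contains all those
    of [p]. *)
Lemma hcomp_sum_id c B p : c <= 0 -> (msize p)%:Z <= c + B%:Z ->
  \sum_(e < B) hcomp (c + e%:Z) p = p.
Proof.
move=> c0 hB; apply/mpolyP => m; rewrite raddf_sum /=.
have [mp|nmp] := boolP (m \in msupp p); last first.
  rewrite (memN_msupp_eq0 nmp) big1 // => e _.
  by rewrite mcoeff_hcomp (memN_msupp_eq0 nmp) if_same.
have hm : (`|(mdeg m)%:Z - c|%N < B)%N by have := msize_mdeg_lt mp; lia.
rewrite (bigD1 (Ordinal hm)) //= mcoeff_hcomp.
rewrite ifT; last by apply/eqP; lia.
rewrite big1 ?addr0 // => e /eqP ne; rewrite mcoeff_hcomp ifF //.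
by apply/eqP => he; apply: ne; apply: val_inj => /=; lia.
Qed.

Lemma hcompM (i j : int) p q : homog_of_deg j q ->
  hcomp (i + j) (p * q) = hcomp i p * q.
Proof.
move=> hq; set B := ((msize p) + `|i|).+1%N.
have -> : p = \sum_(e < B + B) hcomp (- B%:Z + e%:Z) p.
  by rewrite hcomp_sum_id //; lia.
rewrite mulr_suml !hcomp_sum mulr_suml; apply: eq_bigr => e _.
have [<-|ne] := eqVneq (- B%:Z + e%:Z) i.
  rewrite (hcomp_id (hcomp_homog _ _)) hcomp_id //.
  by apply: homog_of_degM => //; apply: hcomp_homog.
have h0 (u v : int) r : homog_of_deg u r -> u != v -> hcomp v r = 0.
  move=> /homog_of_degP hr uv; apply/mpolyP => m; rewrite mcoeff_hcomp mcoeff0.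
  case: ifP => // /eqP mv; apply/eqP/contraT => /hr; rewrite mv => vu.
  by rewrite vu eqxx in uv.
rewrite (h0 _ _ _ (hcomp_homog _ _) ne) mul0r.
apply: h0 (homog_of_degM (hcomp_homog _ _) hq) _.
by rewrite (inj_eq (addIr j)).
Qed.

(** The quotient of [p] by ['X_[w]], discarding the monomials that ['X_[w]] does not
    divide. *)
Lemma ex_divX w p : exists q, forall m, q@_m = p@_(m + w)%MM.
Proof.
elim/mpolyind: p => [|c m p _ _ [q hq]]; first by exists 0 => m; rewrite !mcoeff0.
have [wm|wm] := boolP (w <= m)%MM; last first.
  exists q => m'; rewrite mcoeffD mcoeffZ mcoeffX hq.
  case: eqP => [e|]; last by rewrite mulr0 add0r.
  by move: wm; rewrite e addmC lem_addr.
exists (c *: 'X_[m - w] + q) => m'; rewrite !mcoeffD !mcoeffZ !mcoeffX hq.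
by congr (_ * (nat_of_bool _)%:R + _); rewrite -(eqm_add2r w) submK.
Qed.

(** Membership in the monomial ideal generated by the variables of [s], read off
    the support. *)
Definition in_vars (s : seq 'I_n) p : Prop :=
  forall m, p@_m != 0 -> has (fun i => m i != 0%N) s.

Lemma in_vars_cons i s e p : homog_of_deg e p -> in_vars (i :: s) p ->
  exists2 q, homog_of_deg (e - 1) q & in_vars s (p - 'X_i * q).
Proof.
move=> /homog_of_degP hp ip; have [q hq] := ex_divX U_(i)%MM p; exists q.
  apply/homog_of_degP => m; rewrite hq => /hp <-.
  by rewrite mdegD mdeg1 PoszD addrK.
move=> m; rewrite mcoeffB mcoeffXM mnm1_le.
case: ifPn => mi; first by rewrite hq submK ?mnm1_le // subrr eqxx.
by rewrite subr0 => /ip /=; rewrite (negPf mi).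
Qed.

Lemma in_vars_mulX i s p : i \notin s -> in_vars s ('X_i * p) -> in_vars s p.
Proof.
move=> nis h m pm; have := h (U_(i) + m)%MM.
rewrite mcoeffXM lem_addr addmC addmK => /(_ pm) /hasP[t ts].
rewrite mnmDE mnm1E; have [ti|_] := eqVneq i t; first by rewrite ti ts in nis.
by rewrite addn0 => mt; apply/hasP; exists t.
Qed.

Lemma in_vars_enum p : p@_0%MM = 0 -> forall s, (forall i, i \in s) -> in_vars s p.
Proof.
move=> p0 s hs m pm; apply/hasP.
have [i mi] : exists i, m i != 0%N.
  apply/existsP; apply: contraNT pm; rewrite negb_exists => /forallP h.
  suff -> : m = 0%MM by rewrite p0.
  by apply/mnmP => i; rewrite mnm0E; apply/eqP; move: (h i); rewrite negbK.
by exists i.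
Qed.

End MonomialTools.

Section FreeModules.
Variables (k : fieldType) (n r : nat) (deg : 'I_r -> int).
Local Notation R := {mpoly k[n]}.
Implicit Types (v w : 'rV[R]_r) (j : int) (s : seq 'I_n).

Definition vars s : seq R := [seq 'X_i | i <- s].

Definition free_gr j v : Prop := forall t, homog_of_deg (j - deg t) (v 0 t).
Definition free_comp j v : 'rV[R]_r := \row_t hcomp (j - deg t) (v 0 t).

Lemma free_comp_gr j v : free_gr j (free_comp j v).
Proof. by move=> t; rewrite mxE; apply: hcomp_homog. Qed.

Lemma free_comp_id j v : free_gr j v -> free_comp j v = v.
Proof. by move=> h; apply/rowP => t; rewrite mxE hcomp_id. Qed.

Lemma free_graded s : graded_family free_gr (vars s).
Proof.
split=> [j t|j u v hu hv t|x /mapP[i _ ->] j v hv t]; rewrite mxE.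
- exact: homog_of_deg0.
- by rewrite mxE; apply: homog_of_degB.
by rewrite addrAC addrC; apply: homog_of_degM => //; apply: homog_of_degX.
Qed.

Lemma lincomb_varsP s j v :
  lincomb free_gr (vars s) j v <->
  free_gr j v /\ forall t, in_vars s (v 0 t).
Proof.
elim: s v => [|i s IH] v /=.
  split=> [->|[_ h]].
    split; first exact: (graded0 (free_graded [::])).
    by move=> t m; rewrite mxE mcoeff0 eqxx.
  apply/rowP => t; rewrite mxE; apply/mpolyP => m; rewrite mcoeff0.
  by apply/eqP/contraT => /h.
split.
  move=> [b gb /IH[gv hv]]; split.
    rewrite -[v](subrK ('X_i *: b)) -[X in _ + X]opprK.
    apply: (gradedB (free_graded [::])) => //.
    rewrite -sub0r; apply: (gradedB (free_graded [::])).
      exact: (graded0 (free_graded [::])).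
    rewrite -[j](subrK 1); apply: (gradedM (free_graded [:: i])) => //.
    by rewrite mem_head.
  move=> t m vm /=; have := hv t m; rewrite !mxE mcoeffB mcoeffXM mnm1_le.
  by case: ifP => //= _; rewrite subr0; apply.
move=> [gv hv].
have [b hb1 hb2] := fin_all_exists2 (fun t => in_vars_cons (gv t) (hv t)).
have gb : free_gr (j - 1) (\row_t b t) by move=> t; rewrite mxE addrAC.
exists (\row_t b t) => //; apply/IH; split=> [|t]; last by rewrite !mxE.
apply: (gradedB (free_graded [::])) => //.
rewrite -[j](subrK 1); apply: (gradedM (free_graded [:: i])) => //.
by rewrite mem_head.
Qed.

(** The variables form a regular sequence on a free module: by induction only
    [H_1] is at stake, and there ['X_x v] in [(vars s) F] forces [v] in
    [(vars s) F], since [x] is not in [s]. *)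
Lemma free_kos_acyclic s i j : uniq s -> 1 <= i ->
  kos_acyclic free_gr (vars s) i j.
Proof.
elim: s i j => [|x s IH] i j /=.
  by move=> _ i1; apply: kos_acyclic_gt_size (free_graded [::]) _ => /=; lia.
move=> /andP[nxs us] i1.
have gxs := free_graded (x :: s); have gs := free_graded s.
have [i2|] := boolP (2 <= i).
  by apply: kos_acyclic_cons => //; apply: IH => //; lia.
(* now [i = 1]: the component [b] has homological degree [0] *)
move=> i2; have {i1 i2} -> : i = 1 by lia.
have h1 := IH 1 j us (lexx 1).
move=> [a b] /= [da db] [ab0 _].
rewrite subrr in db; have [v gv eb] := kosdeg0P db.
have : lincomb free_gr (vars s) j ('X_x *: v).
  apply/(kos_in0_boundaryP _ _ gs); exists (- a); first exact: kosdegN.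
  rewrite kosdN kos_in0Z -eb; apply/eqP; rewrite eq_sym -subr_eq0 opprK addrC.
  exact/eqP.
move=> /lincomb_varsP[_ hv].
have : lincomb free_gr (vars s) (j - 1) v.
  apply/lincomb_varsP; split=> // t; apply: (in_vars_mulX nxs).
  by have := hv t; rewrite mxE.
move=> /(kos_in0_boundaryP _ _ gs)[b' db' eb']; rewrite -eb in eb'.
have [||a' da' ea] := h1 (a + 'X_x *: b').
- apply: kosdegD => //; rewrite -[j](subrK 1).
  by apply: (kosdegZ gxs); rewrite ?mem_head.
- by rewrite kosdD kosdZ eb' ab0.
exists (a', - b') => /=.
  by split=> //; rewrite addrK; apply: kosdegN.
by rewrite ea kosdN eb' opprK scalerN addrK.
Qed.

Lemma lincomb_mcoeff0 s j v : (forall i, i \in s) -> free_gr j v ->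
  (forall t, (v 0 t)@_0%MM = 0) -> lincomb free_gr (vars s) j v.
Proof.
by move=> hs gv v0; apply/lincomb_varsP; split=> // t; apply: in_vars_enum.
Qed.

Lemma free_kos_acyclic0 s j : (forall i, i \in s) ->
  kos_acyclic free_gr (vars s) 0 j <-> forall t, deg t != j.
Proof.
move=> hs; split=> [/(kos_acyclic0P _ (free_graded s)) h t|h].
  apply/eqP => tj; have /h/lincomb_varsP[_ /(_ t 0%MM)] : free_gr j (delta_mx 0 t).
    move=> t'; rewrite mxE /=; case: eqP => [->|_] /=; last exact: homog_of_deg0.
    rewrite tj subrr; apply/homog_of_degP => m.
    by rewrite mcoeff1; have [->|] := eqVneq m 0%MM; rewrite ?mdeg0 ?eqxx.
  rewrite mxE !eqxx mcoeff1 eqxx oner_eq0 => /(_ isT)/hasP[i _].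
  by rewrite mnm0E.
apply/(kos_acyclic0P _ (free_graded s)) => v gv.
apply: lincomb_mcoeff0 => // t; apply: homog_mcoeff0 (gv t) _.
by rewrite subr_eq0 eq_sym.
Qed.

End FreeModules.

(** * Betti numbers as Koszul homology *)

Section HomogeneousMatrices.
Variables (k : fieldType) (n r' r : nat).
Variables (deg' : 'I_r' -> int) (deg : 'I_r -> int).
Local Notation R := {mpoly k[n]}.
Variable A : 'M[R]_(r', r).

Definition homog_mx : Prop :=
  forall t s, homog_of_deg (deg' t - deg s) (A t s).

Definition minimal_mx : Prop := forall t s, (A t s)@_0%MM = 0.

Lemma free_comp_mul j (w : 'rV[R]_r') : homog_mx ->
  free_comp deg j (w *m A) = free_comp deg' j w *m A.
Proof.
move=> hA; apply/rowP => s; rewrite !mxE hcomp_sum; apply: eq_bigr => t _.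
by rewrite mxE -(hcompM _ _ (hA t s)) addrA subrK.
Qed.

Lemma free_gr_mul j (w : 'rV[R]_r') : homog_mx ->
  free_gr deg' j w -> free_gr deg j (w *m A).
Proof.
move=> hA hw; rewrite -(free_comp_id hw) -free_comp_mul //.
exact: free_comp_gr.
Qed.

Lemma minimal_mx_mul (w : 'rV[R]_r') s : minimal_mx -> ((w *m A) 0 s)@_0%MM = 0.
Proof.
move=> hA; rewrite mxE raddf_sum big1 // => t _ /=.
by rewrite rmorphM /= hA mulr0.
Qed.

End HomogeneousMatrices.

Section Betti.
Variables (k : fieldType) (n : nat) (M : lmodType {mpoly k[n]}).
Local Notation R := {mpoly k[n]}.
Variables (gr : int -> M -> Prop) (F : free_complex M).
Hypothesis F_min : minimal_graded_resolution gr F.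
(* The graded module resolved by [F] is presented by [phi] in a model [W] that
   may differ from [M]; only the kernel of the augmentation has to agree. *)
Variables (W : lmodType R) (GW : int -> W -> Prop).
Variable phi : {linear 'rV[R]_(res_rank F 0) -> W}.
Variable s : seq 'I_n.
Hypothesis s_uniq : uniq s.
Hypothesis s_all : forall i, i \in s.
Hypothesis phi_ker : forall v, phi v = 0 <-> res_aug F v = 0.
Hypothesis phi_onto : forall j y, GW j y ->
  exists2 v, free_gr (@res_deg _ _ _ F 0) j v & phi v = y.
Hypothesis phi_graded : forall j v,
  free_gr (@res_deg _ _ _ F 0) j v -> GW j (phi v).

(** The graded kernel of the [i]-th map of the resolution, as a family of
    subsets of [F_i]. *)
Definition syz i : int -> 'rV[R]_(res_rank F i) -> Prop :=
  match i return int -> 'rV[R]_(res_rank F i) -> Prop with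
  | 0 => fun j v => free_gr (@res_deg _ _ _ F 0) j v /\ phi v = 0
  | i'.+1 => fun j v => free_gr (@res_deg _ _ _ F i'.+1) j v /\
      mulmxr (res_map F i') v = 0
  end.

Lemma syz_onto i j v : syz (i := i) j v ->
  exists2 w, free_gr (@res_deg _ _ _ F i.+1) j w & mulmxr (res_map F i) w = v.
Proof.
move=> hv; have [gv [w ev]] : free_gr (@res_deg _ _ _ F i) j v /\
    exists w, v = w *m res_map F i.
  case: i v hv => [|i] v [gv v0]; split=> //.
    by apply/(res_exact0 F_min)/phi_ker.
  exact/(res_exact F_min).
exists (free_comp (@res_deg _ _ _ F i.+1) j w); first exact: free_comp_gr.
rewrite /= -(free_comp_mul (deg := @res_deg _ _ _ F i)) -?ev ?free_comp_id //.
exact: (res_map_graded F_min).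
Qed.

Lemma syz_image i j w : free_gr (@res_deg _ _ _ F i.+1) j w ->
  syz (i := i) j (mulmxr (res_map F i) w).
Proof.
move=> gw; have gAw := free_gr_mul (res_map_graded F_min (i := i)) gw.
case: i w gw gAw => [|i] w gw gAw; split=> //.
  by apply/phi_ker/(res_exact0 F_min); exists w.
by apply/(res_exact F_min); exists w.
Qed.

Lemma syz_min i j v : free_gr (@res_deg _ _ _ F i) j v -> syz (i := i) j v ->
  lincomb (free_gr (@res_deg _ _ _ F i)) (vars k s) j v.
Proof.
move=> gv hv; apply: lincomb_mcoeff0 => // t.
have [w _ <-] := syz_onto hv.
by apply: minimal_mx_mul; apply: (res_minimal F_min).
Qed.

(** Dimension shifting, iterated along the resolution. *)
Lemma syz_acyclic i p j : 0 <= p ->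
  kos_acyclic GW (vars k s) (p + i.+1%:Z) j <->
  kos_acyclic (@syz i) (vars k s) p j.
Proof.
elim: i p => [|i IH] p p0.
  apply: kos_acyclic_shift => // [|? ?|? ? gv v0].
  - exact: free_graded.
  - exact: free_kos_acyclic.
  - exact: syz_min.
have -> : p + i.+2%:Z = p + 1 + i.+1%:Z by lia.
rewrite IH ?addr_ge0 //.
apply: (kos_acyclic_shift (phi := mulmxr (res_map F i))) => //.
- exact: free_graded.
- by move=> ? ?; apply: syz_onto.
- by move=> ? ?; apply: syz_image.
- by move=> ? ?; apply: free_kos_acyclic.
- by move=> ? ? gv v0; apply: (syz_min (i := i.+1)).
Qed.

Lemma betti_kos_acyclic i j :
  kos_acyclic GW (vars k s) i%:Z j <->
  forall t : 'I_(res_rank F i), res_deg t != j.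
Proof.
case: i => [|i]; rewrite -(free_kos_acyclic0 k _ _ s_all).
  apply: (kos_acyclic0_shift (phi := phi)) => // [|? ?|? ? gv v0].
  - exact: free_graded.
  - exact: free_kos_acyclic.
  - exact: (syz_min (i := 0)).
rewrite -[i.+1%:Z]add0r syz_acyclic //.
apply: (kos_acyclic0_shift (phi := mulmxr (res_map F i))) => // .
- exact: free_graded.
- by move=> ? ?; apply: syz_onto.
- by move=> ? ?; apply: syz_image.
- by move=> ? ?; apply: free_kos_acyclic.
- by move=> ? ? gv v0; apply: (syz_min (i := i.+1)).
Qed.

End Betti.

(** * Minimal generators of graded submodules of free modules *)

(** A matrix of maximal rank among those whose row space lies in [P]. *)
Lemma subspace_rowspace (K : fieldType) (D : nat) (P : 'rV[K]_D -> Prop) :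
  P 0 -> (forall c u v, P u -> P v -> P (c *: u + v)) ->
  exists A : 'M[K]_D, forall v, P v <-> (v <= A)%MS.
Proof.
move=> P0 PL.
pose Q (A : 'M[K]_D) := forall v : 'rV_D, (v <= A)%MS -> P v.
have [A [QA Amax]] : exists A : 'M_D, Q A /\ forall B : 'M_D, Q B -> (\rank B <= \rank A)%N.
  have Q0 : Q 0 by move=> v; rewrite submx0 => /eqP->.
  suff main e : (exists2 A : 'M_D, Q A & (D <= \rank A + e)%N) ->
      exists A : 'M_D, Q A /\ forall B : 'M_D, Q B -> (\rank B <= \rank A)%N.
    by apply: (main D); exists 0 => //; rewrite leq_addl.
  elim: e => [|e IH] [A QA hA].
    exists A; split=> // B _; apply: leq_trans (rank_leq_row B) _.
    by rewrite addn0 in hA.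
  have [[B QB AB]|nB] := classic (exists2 B : 'M_D, Q B & (\rank A < \rank B)%N).
    by apply: IH; exists B => //; lia.
  by exists A; split=> // B QB; rewrite leqNgt; apply/negP => AB; apply: nB; exists B.
exists A => v; split; last exact: QA.
move=> Pv; have QAv : Q (A + v)%MS.
  move=> w /sub_addsmxP[[u1 u2] /= ->]; rewrite addrC.
  have -> : u2 *m v = u2 0 0 *: v.
    by rewrite [u2]mx11_scalar mul_scalar_mx !mxE eqxx.
  by apply: PL => //; apply: QA; apply: submxMl.
have := Amax _ QAv; rewrite (geq_leqif (mxrank_leqif_sup (addsmxSl A v))).
by rewrite addsmx_sub => /andP[].
Qed.

Section Generators.
Variables (k : fieldType) (n r : nat) (deg : 'I_r -> int).
Local Notation R := {mpoly k[n]}.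
Variable N : 'rV[R]_r -> Prop.

Record homog_submodule : Prop := HomogSubmodule {
  submod0 : N 0;
  submodP : forall (p : R) u v, N u -> N v -> N (p *: u + v);
  submod_comp : forall j v, N v -> N (free_comp deg j v)
}.

Definition sub_gr j (v : 'rV[R]_r) : Prop := free_gr deg j v /\ N v.

Definition row_span l (g : 'M[R]_(l, r)) (v : 'rV[R]_r) : Prop :=
  exists w, v = w *m g.

Hypothesis N_sub : homog_submodule.

Lemma submod_mul l (g : 'M[R]_(l, r)) w : (forall x, N (row x g)) -> N (w *m g).
Proof.
move=> hg; rewrite mulmx_sum_row; apply: big_ind => [|u v hu hv|x _].
- exact: submod0.
- by rewrite -[u]scale1r; apply: submodP.
- by rewrite -[_ *: _]addr0; apply: submodP => //; apply: submod0.
Qed.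

Lemma row_span0 l (g : 'M[R]_(l, r)) : row_span g 0.
Proof. by exists 0; rewrite mul0mx. Qed.

Lemma row_spanP l (g : 'M[R]_(l, r)) p u v :
  row_span g u -> row_span g v -> row_span g (p *: u + v).
Proof.
by move=> [u' ->] [v' ->]; exists (p *: u' + v'); rewrite mulmxDl scalemxAl.
Qed.

Lemma sub_gr_graded s : graded_family sub_gr (vars k s).
Proof.
have hF := free_graded k deg s.
split=> [j|j u v [gu nu] [gv nv]|x xs j v [gv nv]]; split.
- exact: (graded0 hF).
- exact: (submod0 N_sub).
- exact: (gradedB hF).
- by rewrite -scaleN1r addrC; apply: submodP.
- exact: (gradedM hF).
- by rewrite -[_ *: _]addr0; apply: submodP => //; apply: submod0.
Qed.

(** A homogeneous element is determined by its finitely many coefficients, which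
    embeds the graded piece in a space of row vectors over [k]. *)
Lemma homog_piece_fg j : exists l (g : 'M[R]_(l, r)),
  (forall x, sub_gr j (row x g)) /\ forall v, sub_gr j v -> row_span g v.
Proof.
pose B := (`|j| + \sum_t `|deg t|).+1%N.
pose T := ('I_r * 'X_{1..n < B})%type.
(* [flat] lists the coefficients of all the entries *)
pose flat (v : 'rV[R]_r) : 'rV[k]_#|{: T}| :=
  \row_x (let y : T := enum_val x in (v 0 y.1)@_(y.2 : 'X_{1..n < B})).
have flatP c u v : flat (c%:MP *: u + v) = c *: flat u + flat v.
  by apply/rowP => x; rewrite !mxE /= !mxE mcoeffD mcoeffCM.
have flat_inj v : free_gr deg j v -> flat v = 0 -> v = 0.
  move=> gv v0; apply/rowP => t; rewrite mxE; apply/mpolyP => m.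
  rewrite mcoeff0; apply/eqP/contraT => nm.
  have em : (mdeg m)%:Z = j - deg t by have /homog_of_degP := gv t; apply.
  have mB : (mdeg m < B)%N.
    by rewrite /B (bigD1 t) //=; lia.
  have /rowP/(_ (enum_rank ((t, BMultinom mB) : T))) := v0.
  by rewrite !mxE /= enum_rankK /= => /eqP; rewrite (negPf nm).
have grP c u v : sub_gr j u -> sub_gr j v -> sub_gr j (c%:MP *: u + v).
  move=> [gu nu] [gv nv]; split; last exact: submodP.
  move=> t; rewrite !mxE mul_mpolyC; apply/homog_of_degP => m.
  rewrite mcoeffD mcoeffZ; move: (gu t) (gv t) => /homog_of_degP hu /homog_of_degP hv.
  have [->|/hu//] := eqVneq (u 0 t)@_m 0.
  by rewrite mulr0 add0r => /hv.
have gr0 : sub_gr j 0 by apply: (graded0 (sub_gr_graded [::])).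
have flat0 : flat 0 = 0 by apply/rowP => x; rewrite !mxE /= !mxE mcoeff0.
have [||A hA] := @subspace_rowspace k _ (fun y => exists2 v, sub_gr j v & flat v = y).
- by exists 0.
- by move=> c _ _ [u gu <-] [v gv <-]; exists (c%:MP *: u + v); rewrite ?flatP //; apply: grP.
have /fin_all_exists2[b hb eb] : forall x, exists2 v, sub_gr j v & flat v = row x A.
  by move=> x; apply/hA; apply: row_sub.
exists #|{: T}|, (\matrix_x b x); split=> [x|v hv]; first by rewrite rowK.
have /submxP[y ey] : (flat v <= A)%MS by apply/hA; exists v.
pose u := map_mx (@mpolyC n k) y *m \matrix_x b x.
have [gu eu] : sub_gr j u /\ flat u = y *m A.
  rewrite /u !mulmx_sum_row.
  apply: (big_ind2 (fun u z => sub_gr j u /\ flat u = z)) =>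
    [//|u1 z1 u2 z2 [h1 e1] [h2 e2]|x _].
    rewrite -[u1]scale1r -mpolyC1 flatP e1 e2 scale1r; split=> //; exact: grP.
  rewrite rowK mxE -[_ *: b x]addr0; split; first exact: grP.
  by rewrite flatP flat0 addr0 eb.
exists (map_mx (@mpolyC n k) y); apply/eqP; rewrite -subr_eq0 -/u; apply/eqP.
have -> : v - u = (-1)%:MP *: u + v by rewrite mpolyCN mpolyC1 scaleN1r addrC.
apply: flat_inj; first by case: (grP (-1) u v gu hv).
by rewrite flatP eu ey scaleN1r addNr.
Qed.

Lemma ex_deg_bound : exists lo : int, forall t, lo <= deg t.
Proof.
exists (- (\sum_t `|deg t|)%N%:Z) => t.
by rewrite (bigD1 t) //=; lia.
Qed.

Lemma free_gr_lt (lo : int) j (v : 'rV[R]_r) : (forall t, lo <= deg t) -> j < lo ->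
  free_gr deg j v -> v = 0.
Proof.
move=> hlo jlo gv; apply/rowP => t; rewrite mxE.
apply/mpolyP => m; rewrite mcoeff0; apply/eqP/contraT => nm.
have /homog_of_degP/(_ m nm) := gv t; have := hlo t; lia.
Qed.

(** There are finitely many nonzero pieces below a given degree, because the
    degrees of the basis of the free module are bounded below. *)
Lemma low_degrees_fg (b : int) : exists l (deg' : 'I_l -> int) (g : 'M[R]_(l, r)),
  [/\ homog_mx deg' deg g, forall x, N (row x g)
    & forall j v, j < b -> sub_gr j v -> row_span g v].
Proof.
have [lo hlo] := ex_deg_bound.
suff main B : exists l (deg' : 'I_l -> int) (g : 'M[R]_(l, r)),
  [/\ homog_mx deg' deg g, forall x, N (row x g)
    & forall j v, j < lo + B%:Z -> sub_gr j v -> row_span g v].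
  have [l [deg' [g [h1 h2 h3]]]] := main `|b - lo|%N.
  by exists l, deg', g; split=> // j v jb; apply: h3; lia.
elim: B => [|B [l1 [deg1 [g1 [h1 n1 s1]]]]].
  exists 0%N, (fun _ => 0), 0; split=> [[]//|[]//|j v jlo [gv nv]].
  rewrite addr0 in jlo; rewrite (free_gr_lt hlo jlo gv); exact: row_span0.
have [l2 [g2 [h2 s2]]] := homog_piece_fg (lo + B%:Z).
exists (l1 + l2)%N.
exists (fun x => match split x with inl y => deg1 y | inr _ => lo + B%:Z end).
exists (col_mx g1 g2); split=> [x t|x|j v jB hv].
- rewrite mxE; case: splitP => y _; first exact: h1.
  by have [/(_ t)] := h2 y; rewrite mxE.
- rewrite -[x]splitK; case: (split x) => y /=.
    by rewrite rowKu.
  by rewrite rowKd; case: (h2 y).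
have [ej|nj] := eqVneq j (lo + B%:Z).
  rewrite ej in hv; have [w ->] := s2 v hv; exists (row_mx 0 w).
  by rewrite mul_row_col mul0mx add0r.
have [||w ->] := s1 j v => //; first by lia.
by exists (row_mx w 0); rewrite mul_row_col mul0mx addr0.
Qed.

Lemma row_span_lincomb l (g : 'M[R]_(l, r)) s j v :
  (forall u, sub_gr (j - 1) u -> row_span g u) ->
  lincomb sub_gr (vars k s) j v -> row_span g v.
Proof.
move=> hg; elim: s v => [|i s IH] v /=; first by move=> ->; apply: row_span0.
move=> [b /hg gb /IH gv]; rewrite -(subrK ('X_i *: b) v) addrC.
exact: row_spanP.
Qed.

Lemma all_degrees_span l (g : 'M[R]_(l, r)) :
  (forall j v, sub_gr j v -> row_span g v) -> forall v, N v -> row_span g v.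
Proof.
move=> hg v nv; have [lo hlo] := ex_deg_bound.
pose B := (\sum_(t < r) (msize (v 0%R t) + `|(deg t - lo)%R|))%N.
have -> : v = \sum_(e < B) free_comp deg (lo + e%:Z) v.
  apply/rowP => t; rewrite summxE.
  under eq_bigr do rewrite mxE addrAC.
  rewrite hcomp_sum_id //; first by rewrite subr_le0.
  by rewrite /B (bigD1 t) //=; have := hlo t; lia.
apply: big_ind => [|u1 u2 h1 h2|e _]; first exact: row_span0.
  by rewrite -[u1]scale1r; apply: row_spanP.
apply: (hg (lo + e%:Z)); split; [exact: free_comp_gr | exact: submod_comp].
Qed.

Definition generates l (deg' : 'I_l -> int) (g : 'M[R]_(l, r)) : Prop :=
  [/\ homog_mx deg' deg g, forall x, N (row x g) & forall v, N v -> row_span g v].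

(** Graded Nakayama: if [N_j] lies in [(vars k s) N] for [j > c], then
    generators of the pieces of degree at most [c] generate [N]. *)
Lemma ex_generators s (c : int) :
  (forall j, c < j -> kos_acyclic sub_gr (vars k s) 0 j) ->
  exists l (deg' : 'I_l -> int) (g : 'M[R]_(l, r)), generates deg' g.
Proof.
move=> hc; have [l [deg' [g [h1 h2 h3]]]] := low_degrees_fg (c + 1).
exists l, deg', g; split=> //; apply: all_degrees_span.
suff main B j v : j < c + 1 + B%:Z -> sub_gr j v -> row_span g v.
  by move=> j v; apply: (main `|j - c|%N); lia.
elim: B j v => [|B IH] j v jB; first by apply: h3; rewrite addr0 in jB.
have [jc|cj] := boolP (j < c + 1); first exact: h3.
move=> hv; apply: (row_span_lincomb (s := s) (j := j)) => [u|].
  by apply: IH; lia.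
by apply: (kos_acyclic0P j (sub_gr_graded s)).1 => //; apply: hc; lia.
Qed.

Lemma mulmx_lift l (w : 'rV[R]_l.+1) (g : 'M[R]_(l.+1, r)) t :
  w *m g = w 0 t *: row t g + col' t w *m row' t g.
Proof.
apply/rowP => i; rewrite !mxE (bigD1_ord t) //=; congr (_ + _).
by apply: eq_bigr => x _; rewrite !mxE.
Qed.

(** If some relation has a nonzero constant coefficient at [t], its component of
    degree [deg' t] expresses the [t]-th generator by the others; dropping that
    generator leaves a shorter generating family. *)
Lemma ex_minimal_generators l (deg' : 'I_l -> int) (g : 'M[R]_(l, r)) :
  generates deg' g ->
  exists l (deg' : 'I_l -> int) (g : 'M[R]_(l, r)), generates deg' g /\
    forall w : 'rV_l, w *m g = 0 -> forall t, (w 0 t)@_0%MM = 0.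
Proof.
elim: l deg' g => [|l IH] deg' g [hh hN hg].
  by exists 0%N, deg', g; split=> // w _ [].
have [hmin|nmin] := classic (forall w : 'rV_l.+1, w *m g = 0 -> forall t, (w 0 t)@_0%MM = 0).
  by exists l.+1, deg', g.
have [w [t [wg0 /eqP wt]]] : exists (w : 'rV_l.+1) t, w *m g = 0 /\ (w 0 t)@_0%MM <> 0.
  apply: NNPP => h; apply: nmin => w w0 t; apply: NNPP => wt; apply: h.
  by exists w, t.
pose u := free_comp deg' (deg' t) w.
have ug0 : u *m g = 0.
  rewrite -(free_comp_mul _ _ hh) wg0; apply/rowP => i; rewrite !mxE.
  by rewrite hcomp_id //; apply: homog_of_deg0.
pose a := (w 0 t)@_0%MM.
have ut : u 0 t = a%:MP.
  rewrite mxE subrr; apply/mpolyP => m; rewrite mcoeff_hcomp mcoeffC.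
  rewrite eqz_nat mdeg_eq0.
  by have [->|] := eqVneq m 0%MM; rewrite ?mulr1 ?mulr0.
have gt : row t g = (- a^-1)%:MP *: col' t u *m row' t g.
  move: ug0; rewrite (mulmx_lift _ _ t) ut => /eqP.
  rewrite addr_eq0 => /eqP/(congr1 (fun z => a^-1%:MP *: z)).
  rewrite scalerA -mpolyCM mulVf // mpolyC1 scale1r => ->.
  by rewrite scalerN -scaleNr -mpolyCN scalemxAl.
apply: (IH (deg' \o lift t) (row' t g)); split=> [x i|x|v /hg[z ->]].
- by rewrite mxE; apply: hh.
- have -> : row x (row' t g) = row (lift t x) g by apply/rowP => i; rewrite !mxE.
  exact: hN.
exists (z 0 t *: ((- a^-1)%:MP *: col' t u) + col' t z).
by rewrite (mulmx_lift _ _ t) gt mulmxDl -!scalemxAl.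
Qed.

End Generators.

(** * Existence of minimal graded resolutions *)

Section ResolutionExistence.
Variables (k : fieldType) (n : nat) (s : seq 'I_n).
Local Notation R := {mpoly k[n]}.
Hypothesis s_uniq : uniq s.
Hypothesis s_all : forall i : 'I_n, i \in s.

(** What the construction of a resolution carries from one step to the next: a
    graded submodule of a free module, contained in the product by the ideal of
    the variables, with bounded slopes. *)
Record syzygy_stage := SyzygyStage {
  stage_rank : nat;
  stage_deg : 'I_stage_rank -> int;
  stage_mod : 'rV[R]_stage_rank -> Prop;
  stage_sub : homog_submodule stage_deg stage_mod;
  stage_min : forall v, stage_mod v -> forall t, (v 0 t)@_0%MM = 0;
  stage_reg : exists c, forall i j, c < j - i ->
    kos_acyclic (sub_gr stage_deg stage_mod) (vars k s) i j
}.

(** Minimal generators of the current module span the next free module; their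
    relations form the next stage, with slopes bounded by [c + 1] by dimension
    shifting. *)
Lemma next_stage (S : syzygy_stage) : exists (S' : syzygy_stage)
    (A : 'M[R]_(stage_rank S', stage_rank S)),
  [/\ homog_mx (@stage_deg S') (@stage_deg S) A, minimal_mx A,
      forall v, stage_mod v <-> exists w, v = w *m A
    & forall w : 'rV_(stage_rank S'), stage_mod w <-> w *m A = 0].
Proof.
case: S => r deg N Nsub Nmin [c hc] /=.
have [|l0 [d0 [g0 gen0]]] := ex_generators Nsub (s := s) (c := c).
  by move=> j cj; apply: hc; lia.
have [l [deg' [A [[hA hN hgen] Amin]]]] := ex_minimal_generators gen0.
have Asub : homog_submodule deg' (fun w => w *m A = 0).
  split=> [|p u v u0 v0|j v v0]; first by rewrite mul0mx.
    by rewrite mulmxDl -scalemxAl u0 v0 scaler0 addr0.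
  rewrite -(free_comp_mul _ _ hA) v0; apply/rowP => i; rewrite !mxE.
  by rewrite hcomp_id //; apply: homog_of_deg0.
have Areg : exists c', forall i j, c' < j - i ->
    kos_acyclic (sub_gr deg' (fun w => w *m A = 0)) (vars k s) i j.
  exists (c + 1) => i j cij.
  have [i0|i0] := boolP (i < 0).
    by apply: kos_acyclic_lt0 => //; apply: sub_gr_graded Asub _.
  apply/(kos_acyclic_shift (phi := mulmxr A) (GW := sub_gr deg N)).
  - exact: free_graded.
  - move=> j' v [gv /hgen[w ev]]; exists (free_comp deg' j' w).
      exact: free_comp_gr.
    by rewrite /= -(free_comp_mul _ _ hA) -ev free_comp_id.
  - move=> j' v gv; split; first exact: free_gr_mul gv.
    exact: (submod_mul Nsub).
  - by move=> ? ?; apply: free_kos_acyclic.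
  - by move=> j' v gv v0; apply: lincomb_mcoeff0 => //; apply: Amin.
  - by lia.
  by apply: hc; lia.
exists (SyzygyStage Asub Amin Areg), A; split=> //=.
  move=> x t; have := Nmin _ (hN x) t; by rewrite mxE.
move=> v; split; first exact: hgen.
by move=> [w ->]; apply: (submod_mul Nsub).
Qed.

Variables (M : lmodType R) (gr : int -> M -> Prop).
Variables (S0 : syzygy_stage) (aug : {linear 'rV[R]_(stage_rank S0) -> M}).
Hypothesis aug_onto : forall x, exists v, aug v = x.
Hypothesis aug_graded : forall t, gr (stage_deg t) (aug (delta_mx 0 t)).
Hypothesis aug_ker : forall v, stage_mod v <-> aug v = 0.

Lemma ex_minimal_resolution : exists F : free_complex M, minimal_graded_resolution gr F.
Proof.
pose step S := constructive_indefinite_description _ (next_stage S).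
pose stage i := iter i (fun S => sval (step S)) S0.
pose stepmx i := constructive_indefinite_description _ (svalP (step (stage i))).
have stepP i := svalP (stepmx i).
exists (@FreeComplex n k M (fun i => stage_rank (stage i))
  (fun i => @stage_deg (stage i)) (fun i => sval (stepmx i)) aug).
split=> //= [v|i v|i|i].
- rewrite -aug_ker; case: (stepP 0%N) => _ _ h _; exact: h.
- case: (stepP i.+1) => _ _ h _; case: (stepP i) => _ _ _ h'.
  by rewrite -h' h.
- by case: (stepP i).
- by case: (stepP i).
Qed.

End ResolutionExistence.

(** * The semigroup ring inside polynomials in two variables *)

Section ToricMap.
Variables (k : fieldType) (n d : nat) (a : nat -> nat).
Local Notation R := {mpoly k[n]}.
Implicit Types (p q : R) (m : 'X_{1..n}) (e f : 'X_{1..2}) (i : 'I_n) (j : int).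

Lemma toric_map_linear c p q : toric_map d a (c *: p + q) = c *: toric_map d a p + toric_map d a q.
Proof. exact: linearP. Qed.

Lemma toric_mapD p q : toric_map d a (p + q) = toric_map d a p + toric_map d a q.
Proof. exact: rmorphD. Qed.

Lemma toric_mapM p q : toric_map d a (p * q) = toric_map d a p * toric_map d a q.
Proof. exact: rmorphM. Qed.

Definition gen_exp i : 'X_{1..2} :=
  [multinom (if t == ord0 then a i else d - a i)%N | t < 2].

Definition toric_exp m : 'X_{1..2} := (\sum_(i < n) gen_exp i *+ m i)%MM.

Lemma toric_mapX m : toric_map d a ('X_[m] : R) = 'X_[toric_exp m].
Proof.
rewrite /toric_map comp_mpolyX -mprodXnE; apply: eq_bigr => i _; congr (_ ^+ _).
rewrite tnth_mktuple !mpolyXn -mpolyXD; congr 'X_[_].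
apply/mnmP => t; rewrite mnmDE !mulmnE !mnm1E mnmE.
by case: t => [[|[|//]]] ?; rewrite -!val_eqE /= ?mul1n ?addn0.
Qed.

Lemma toric_expD m m' : toric_exp (m + m') = (toric_exp m + toric_exp m')%MM.
Proof.
apply/mnmP => t; rewrite mnmDE !mnm_sumE -big_split; apply: eq_bigr => i _ /=.
by rewrite !mulmnE mnmDE mulnDr.
Qed.

Lemma toric_exp1 i : toric_exp U_(i) = gen_exp i.
Proof.
rewrite /toric_exp (bigD1 i) //= mnm1E eqxx mulm1n big1 ?addm0 // => t ti.
by rewrite mnm1E eq_sym (negPf ti) mulm0n.
Qed.

Lemma toric_exp0 m : toric_exp m ord0 = (\sum_(i < n) a i * m i)%N.
Proof.
by rewrite /toric_exp mnm_sumE; apply: eq_bigr => i _; rewrite mulmnE mnmE.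
Qed.

Lemma toric_exp_max m : toric_exp m ord_max = (\sum_(i < n) (d - a i) * m i)%N.
Proof.
by rewrite /toric_exp mnm_sumE; apply: eq_bigr => i _; rewrite mulmnE mnmE.
Qed.

Lemma mdeg2 e : mdeg e = (e ord0 + e ord_max)%N.
Proof. by rewrite mdegE big_ord_recl big_ord1; congr (_ + e _)%N; apply: val_inj. Qed.

Hypothesis ha_le : forall i, (a i <= d)%N.
Hypothesis d_gt0 : (0 < d)%N.

Lemma mdeg_toric_exp m : mdeg (toric_exp m) = (mdeg m * d)%N.
Proof.
rewrite mdeg2 toric_exp0 toric_exp_max -big_split mdegE big_distrl /=.
by apply: eq_bigr => i _; rewrite -mulnDl subnKC // mulnC.
Qed.

Definition in_sgp e : Prop := exists m, e = toric_exp m.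

Lemma in_sgp0 : in_sgp 0%MM.
Proof.
by exists 0%MM; rewrite /toric_exp big1 // => i _; rewrite mnm0E mulm0n.
Qed.

Lemma in_sgpD e f : in_sgp e -> in_sgp f -> in_sgp (e + f)%MM.
Proof. by move=> [m ->] [m' ->]; exists (m + m')%MM; rewrite toric_expD. Qed.

Lemma in_sgp_gen i : in_sgp (gen_exp i).
Proof. by exists U_(i)%MM; rewrite toric_exp1. Qed.

(** The span of the monomials whose exponent is a point of the semigroup of level
    [j]; by [toric_gr_imageP] it is the image of the forms of degree [j]. *)
Definition toric_gr j (q : {mpoly k[2]}) : Prop :=
  forall e, q@_e != 0 -> in_sgp e /\ (mdeg e)%:Z = j * d%:Z.

Lemma toric_gr0 j : toric_gr j 0.
Proof. by move=> e; rewrite mcoeff0 eqxx. Qed.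

Lemma toric_grP j c u v : toric_gr j u -> toric_gr j v -> toric_gr j (c *: u + v).
Proof.
move=> hu hv e; rewrite mcoeffD mcoeffZ.
by have [->|/hu//] := eqVneq u@_e 0; rewrite mulr0 add0r => /hv.
Qed.

Lemma toric_grX e j : in_sgp e -> (mdeg e)%:Z = j * d%:Z -> toric_gr j 'X_[e].
Proof.
by move=> se de f; rewrite mcoeffX; have [<-|] := eqVneq e f; rewrite ?eqxx.
Qed.

Lemma toric_gr_ind j (P : {mpoly k[2]} -> Prop) :
  P 0 -> (forall c u v, P u -> P v -> P (c *: u + v)) ->
  (forall e, in_sgp e -> (mdeg e)%:Z = j * d%:Z -> P 'X_[e]) ->
  forall u, toric_gr j u -> P u.
Proof.
move=> P0 PL PX u hu; rewrite [u]mpolyE big_seq.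
apply: (big_ind P) => // [v w Pv Pw|e].
  by rewrite -[v]scale1r; apply: PL.
by rewrite mcoeff_msupp -[_ *: _]addr0 => /hu[se de]; apply: PL => //; apply: PX.
Qed.

Lemma toric_gr_imageP j (q : {mpoly k[2]}) :
  toric_gr j q <-> exists p : R, homog_of_deg j p /\ q = toric_map d a p.
Proof.
split=> [h|[p [/homog_of_degP hp ->]]].
  apply: (toric_gr_ind (P := fun u => exists p : R, homog_of_deg j p /\ u = toric_map d a p)
    _ _ _ h) => [|c u v [p [hp ->]] [p' [hp' ->]]|_ [m ->]].
  - by exists 0; rewrite homog_of_deg0 /toric_map rmorph0.
  - exists (c *: p + p'); rewrite toric_map_linear; split=> //.
    apply/homog_of_degP => m; rewrite mcoeffD mcoeffZ.
    move: hp hp' => /homog_of_degP hp /homog_of_degP hp'.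
    by have [->|/hp//] := eqVneq p@_m 0; rewrite mulr0 add0r => /hp'.
  - rewrite mdeg_toric_exp PoszM => /mulIf hm; exists 'X_[m]; rewrite toric_mapX.
    split=> //; apply/homog_of_degP => m'; rewrite mcoeffX.
    have [<- _|] := eqVneq m m'; last by rewrite eqxx.
    by apply: hm; rewrite eqz_nat -lt0n.
rewrite /toric_map comp_mpolyEX big_seq.
apply: (big_ind (toric_gr j)) => [|u v hu hv|m]; first exact: toric_gr0.
  by rewrite -[u]scale1r; apply: toric_grP.
rewrite mcoeff_msupp => /hp <-; rewrite -[_ *: _]addr0; apply: toric_grP.
  rewrite [X in toric_gr _ X](toric_mapX m); apply: toric_grX; first by exists m.
  by rewrite mdeg_toric_exp PoszM.
exact: toric_gr0.
Qed.

Lemma toric_grM (i j : int) p (q : {mpoly k[2]}) :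
  homog_of_deg i p -> toric_gr j q -> toric_gr (i + j) (toric_map d a p * q).
Proof.
move=> hp /toric_gr_imageP[p' [hp' ->]]; apply/toric_gr_imageP.
by exists (p * p'); rewrite toric_mapM; split=> //; apply: homog_of_degM.
Qed.

Lemma toric_gr_homog j (q : {mpoly k[2]}) : toric_gr j q -> homog_of_deg (j * d%:Z) q.
Proof. by move=> h; apply/homog_of_degP => e /h[]. Qed.

Lemma hcomp_toric j p : hcomp (j * d%:Z) (toric_map d a p) = toric_map d a (hcomp j p).
Proof.
elim/mpolyind: p => [|c m p _ _ IH].
  by rewrite hcomp0 /toric_map rmorph0 hcomp0.
rewrite toric_map_linear !hcomp_linear toric_map_linear IH; congr (_ *: _ + _).
rewrite toric_mapX; have [ej|nj] := eqVneq (mdeg m)%:Z j.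
  rewrite !hcomp_id ?toric_mapX //; apply/homog_of_degP => m'; rewrite mcoeffX.
    by have [<-|] := eqVneq m m'; rewrite ?eqxx.
  by have [<-|] := eqVneq _ m'; rewrite ?eqxx // mdeg_toric_exp PoszM ej.
have -> : hcomp j ('X_[m] : R) = 0.
  apply/mpolyP => m'; rewrite mcoeff_hcomp mcoeffX mcoeff0.
  by have [<-|] := eqVneq m m'; rewrite ?if_same // (negPf nj).
rewrite /toric_map rmorph0; apply/mpolyP => e; rewrite mcoeff_hcomp mcoeffX mcoeff0.
have [<-|] := eqVneq _ e; rewrite ?if_same // mdeg_toric_exp PoszM.
by rewrite (inj_eq (mulIf _)) ?(negPf nj) // eqz_nat -lt0n.
Qed.

(** The variables go to nonconstant monomials, so the toric ideal has no
    constant terms. *)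
Lemma toric_map_mcoeff0 p : toric_map d a p = 0 -> p@_0%MM = 0.
Proof.
move=> p0; have := hcomp_toric 0 p; rewrite p0 mul0r.
have -> : hcomp 0 p = p@_0%MM *: 'X_[0].
  apply/mpolyP => m; rewrite mcoeff_hcomp mcoeffZ mcoeffX eqz_nat mdeg_eq0 eq_sym.
  by have [->|] := eqVneq 0%MM m; rewrite ?mulr1 ?mulr0.
rewrite -[_ *: _]addr0 toric_map_linear /toric_map rmorph0 addr0 [comp_mpoly _ _]toric_mapX.
move/(congr1 (mcoeff (toric_exp 0%MM))); rewrite mcoeffZ mcoeffX eqxx mulr1 => <-.
by rewrite mcoeff_hcomp mcoeff0 if_same.
Qed.

End ToricMap.

(** Polynomials in two variables as a module over the coordinates of the
    projective space, along the toric map.  The coordinate ring of the curve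
    embeds in it by [curve_toric], and Koszul homology is computed there,
    monomial by monomial. *)
Definition toric_module (k : fieldType) (n d : nat) (a : nat -> nat) : Type :=
  {mpoly k[2]}.

Section ToricModule.
Variables (k : fieldType) (n d : nat) (a : nat -> nat).
Local Notation R := {mpoly k[n]}.
Local Notation T := (toric_module k n d a).

HB.instance Definition _ := GRing.Zmodule.copy T {mpoly k[2]}.

Definition toric_scale (p : R) (q : T) : T := toric_map d a p * (q : {mpoly k[2]}).

Lemma toric_scaleA p q u : toric_scale p (toric_scale q u) = toric_scale (p * q) u.
Proof. by rewrite /toric_scale mulrA -toric_mapM. Qed.

Lemma toric_scale1 : left_id 1 toric_scale.
Proof. by move=> u; rewrite /toric_scale /toric_map rmorph1 mul1r. Qed.

Lemma toric_scaleDr : right_distributive toric_scale +%R.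
Proof. by move=> p u v; apply: mulrDr. Qed.

Lemma toric_scaleDl u : {morph toric_scale^~ u : p q / p + q}.
Proof. by move=> p q; rewrite /toric_scale toric_mapD mulrDl. Qed.

HB.instance Definition _ := GRing.Zmodule_isLmodule.Build R T
  toric_scaleA toric_scale1 toric_scaleDr toric_scaleDl.

Lemma toric_scaleE (p : R) (u : T) : p *: u = toric_map d a p * (u : {mpoly k[2]}) :> {mpoly k[2]}.
Proof. by []. Qed.

Local Notation C := (curve_ring k n d a).

Definition curve_toric (x : C) : T := toric_map d a (repr x).

Lemma curve_projK (x : C) : curve_proj d a (repr x) = x.
Proof. exact: reprK. Qed.

Lemma curve_proj_eq p q : curve_proj d a p = curve_proj d a q :> C <->
  toric_map d a p = toric_map d a q.
Proof.
have -> : (toric_map d a p = toric_map d a q) <-> (p - q \in @toric_ideal k n d a).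
  rewrite unfold_in /toric_map rmorphB subr_eq0.
  by split=> /eqP.
rewrite Quotient.idealrBE; split=> [h|/eqP//].
exact/eqP.
Qed.

Lemma curve_toric_proj p : curve_toric (curve_proj d a p) = toric_map d a p.
Proof. by apply/curve_proj_eq; rewrite curve_projK. Qed.

Lemma curve_projP (p q r : R) :
  curve_proj d a (p * q + r) = p *: (curve_proj d a q : C) + curve_proj d a r.
Proof. by rewrite /curve_proj rmorphD rmorphM. Qed.

Lemma curve_toric_linear (p : R) (x y : C) :
  curve_toric (p *: x + y) = p *: curve_toric x + curve_toric y.
Proof.
rewrite -[x]curve_projK -[y]curve_projK -curve_projP !curve_toric_proj.
by rewrite toric_mapD toric_mapM.
Qed.

Lemma curve_toric_eq0 x : curve_toric x = 0 <-> x = 0.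
Proof.
have c0 : curve_toric 0 = 0.
  by have := curve_toric_linear (-1) 0 0; rewrite scaler0 addr0 scaleN1r addNr.
split=> [|->//]; rewrite -[x]curve_projK curve_toric_proj => h.
rewrite -[0]curve_projK; apply/curve_proj_eq; rewrite h.
by rewrite -[LHS]c0.
Qed.

End ToricModule.

Section Presentation.
Variables (k : fieldType) (n d : nat) (a : nat -> nat).
Local Notation R := {mpoly k[n]}.
Local Notation C := (curve_ring k n d a).
Local Notation T := (toric_module k n d a).
Local Notation GT := (toric_gr (k := k) n d a : int -> T -> Prop).
Hypothesis ha_le : forall i : 'I_n, (a i <= d)%N.
Hypothesis d_gt0 : (0 < d)%N.

Lemma toric_module_graded s : graded_family GT (vars k s).
Proof.
split=> [j|j u v hu hv|_ /mapP[i _ ->] j v hv]; first exact: toric_gr0.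
  by have := toric_grP (c := -1) hv hu; rewrite scaleN1r addrC.
by rewrite addrC; apply: toric_grM => //; apply: homog_of_degX.
Qed.

Lemma curve_gr_toric j (x : C) : curve_gr j x <-> GT j (curve_toric x).
Proof.
split=> [[p [hp ->]]|/toric_gr_imageP[//|//|p [hp e]]].
  by apply/toric_gr_imageP => //; exists p; rewrite curve_toric_proj.
by exists p; split=> //; rewrite -[x]curve_projK; apply/curve_proj_eq.
Qed.

Variables (r : nat) (deg : 'I_r -> int) (aug : {linear 'rV[R]_r -> C}).
Hypothesis aug_onto : forall x, exists v, aug v = x.
Hypothesis aug_graded : forall t, curve_gr (deg t) (aug (delta_mx 0 t)).

(** The composite of an augmentation [aug] onto the coordinate ring with the
    embedding [curve_toric]; it has the kernel of [aug], and its image is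
    described by [toric_gr]. *)
Definition toric_aug (v : 'rV[R]_r) : T := curve_toric (aug v).

Lemma toric_aug_linear : linear toric_aug.
Proof. by move=> p u v; rewrite /toric_aug linearP curve_toric_linear. Qed.

HB.instance Definition _ := GRing.isLinear.Build R 'rV[R]_r T *:%R toric_aug
  toric_aug_linear.

Lemma toric_aug_ker v : toric_aug v = 0 <-> aug v = 0.
Proof. exact: curve_toric_eq0. Qed.

Lemma toric_augE v : toric_aug v =
  \sum_t toric_map d a (v 0 t) * (toric_aug (delta_mx 0 t) : {mpoly k[2]}).
Proof.
rewrite {1}[v]row_sum_delta linear_sum; apply: eq_bigr => t _.
by rewrite linearZ.
Qed.

Lemma toric_aug_basis t : GT (deg t) (toric_aug (delta_mx 0 t)).
Proof. exact/curve_gr_toric. Qed.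

(** As the images of the basis vectors are homogeneous, taking components
    commutes with the augmentation; hence homogeneous elements have homogeneous
    lifts. *)
Lemma toric_aug_comp j v : toric_aug (free_comp deg j v) = hcomp (j * d%:Z) (toric_aug v).
Proof.
rewrite !toric_augE hcomp_sum; apply: eq_bigr => t _.
rewrite mxE -hcomp_toric // mulrBl.
by rewrite -(hcompM _ _ (toric_gr_homog (toric_aug_basis (t := t)))) subrK.
Qed.

Lemma toric_aug_graded j v : free_gr deg j v -> GT j (toric_aug v).
Proof.
move=> gv; rewrite toric_augE; apply: (big_ind (toric_gr n d a j)).
- exact: toric_gr0.
- by move=> u1 u2 h1 h2; rewrite -[u1]scale1r; apply: toric_grP.
move=> t _; rewrite -[j](subrK (deg t)).
by apply: toric_grM => //; apply: toric_aug_basis.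
Qed.

Lemma toric_aug_onto j y : GT j y -> exists2 v, free_gr deg j v & toric_aug v = y.
Proof.
move=> gy; have [p [_ ey]] := (toric_gr_imageP ha_le d_gt0 j y).1 gy.
have [v ev] := aug_onto (curve_proj d a p).
exists (free_comp deg j v); first exact: free_comp_gr.
rewrite toric_aug_comp /toric_aug ev curve_toric_proj -ey.
by apply: hcomp_id; apply: toric_gr_homog gy.
Qed.

End Presentation.

(** * Koszul homology of the two end variables *)

Section BaseCase.
Variables (k : fieldType) (n d : nat) (a : nat -> nat).
Local Notation R := {mpoly k[n]}.
Local Notation T := (toric_module k n d a).
Local Notation GT := (toric_gr (k := k) n d a : int -> T -> Prop).
Implicit Types (e f : 'X_{1..2}) (j : int).
Hypothesis ha_le : forall i : 'I_n, (a i <= d)%N.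
Hypothesis d_gt0 : (0 < d)%N.
Variables i0 i1 : 'I_n.
Local Notation A0 := (gen_exp d a i0).
Local Notation A1 := (gen_exp d a i1).
Local Notation S := (in_sgp n d a).
Local Notation ends := [:: 'X_i0; 'X_i1 : R].

Definition apery e : Prop :=
  [/\ S e, ~ (exists2 f, S f & e = A0 + f)%MM & ~ (exists2 f, S f & e = A1 + f)%MM].

Definition exceptional e : Prop :=
  [/\ S e, (exists2 f, S f & e = A0 + f)%MM, (exists2 f, S f & e = A1 + f)%MM
    & ~ (exists2 f, S f & e = A0 + A1 + f)%MM].

Lemma scaleX (i : 'I_n) (u : T) : 'X_i *: u = 'X_[gen_exp d a i] * (u : {mpoly k[2]}).
Proof. by rewrite toric_scaleE [toric_map _ _ _]toric_mapX toric_exp1. Qed.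

Lemma ends_graded : graded_family GT ends.
Proof. exact: (toric_module_graded _ ha_le d_gt0 [:: i0; i1]). Qed.

Lemma mdeg_gen_exp (i : 'I_n) : mdeg (gen_exp d a i) = d.
Proof. by rewrite -toric_exp1 (mdeg_toric_exp ha_le) // mdeg1 mul1n. Qed.

Lemma mdeg_shift (i : 'I_n) f j : (mdeg (gen_exp d a i + f)%MM)%:Z = j * d%:Z ->
  (mdeg f)%:Z = (j - 1) * d%:Z.
Proof. by rewrite mdegD mdeg_gen_exp PoszD mulrBl mul1r => <-; ring. Qed.

Lemma toric_gr_coef_shift (i : 'I_n) j (u : T) e :
  GT j u -> ('X_[gen_exp d a i] * (u : {mpoly k[2]}))@_e != 0 ->
  exists2 f, S f & e = (gen_exp d a i + f)%MM.
Proof.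
move=> gu; rewrite mcoeffXM; case: ifP => [le|_]; last by rewrite eqxx.
by move=> /gu[sf _]; exists (e - gen_exp d a i)%MM => //; rewrite addmC submK.
Qed.

(** [H_0] is [M / (x_0, x_(n-1)) M], in which a monomial survives if and only if
    its exponent is an Apery element. *)
Lemma apery_kos j : ~ kos_acyclic GT ends 0 j <->
  exists2 e, apery e & (mdeg e)%:Z = j * d%:Z.
Proof.
rewrite (kos_acyclic0P _ ends_graded) /=; split=> [nac|[e [se n0 n1] de] h].
  apply: NNPP => nap; apply: nac => u.
  pose P (v : T) := exists2 b : T, GT (j - 1) b &
    exists2 c : T, GT (j - 1) c & v - 'X_i0 *: b - 'X_i1 *: c = 0.
  apply: (toric_gr_ind (P := P)) => [|c v w [b1 gb1 [c1 gc1 e1]] [b2 gb2 [c2 gc2 e2]]|e se de].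
  - by exists 0; [exact: toric_gr0|exists 0; [exact: toric_gr0|]]; rewrite !scaler0 !subr0.
  - exists (c *: (b1 : {mpoly k[2]}) + b2); first exact: toric_grP.
    exists (c *: (c1 : {mpoly k[2]}) + c2); first exact: toric_grP.
    move/eqP: e1; rewrite !scaleX -addrA -opprD subr_eq0 => /eqP->.
    move/eqP: e2; rewrite !scaleX -addrA -opprD subr_eq0 => /eqP->.
    rewrite !mulrDr -!scalerAr scalerDr; ring.
  have [[f sf ef]|nf0] := classic (exists2 f, S f & e = A0 + f)%MM.
    exists 'X_[f]; first by apply: toric_grX => //; apply: (mdeg_shift (i := i0)); rewrite -ef.
    by exists 0; rewrite ?scaler0 ?scaleX -?mpolyXD -?ef ?subrr ?subr0 //; apply: toric_gr0.
  have [[f sf ef]|nf1] := classic (exists2 f, S f & e = A1 + f)%MM.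
    exists 0; first exact: toric_gr0.
    exists 'X_[f]; first by apply: toric_grX => //; apply: (mdeg_shift (i := i1)); rewrite -ef.
    by rewrite scaler0 subr0 scaleX -mpolyXD -ef subrr.
  by case: nap; exists e.
have [b gb [c gc]] := h 'X_[e] (toric_grX se de).
rewrite !scaleX => /(congr1 (mcoeff e)).
rewrite mcoeff0 !mcoeffB mcoeffX eqxx.
have -> : ('X_[A0] * (b : {mpoly k[2]}))@_e = 0.
  by apply/eqP; apply: contra_notT n0; apply: toric_gr_coef_shift gb.
have -> : ('X_[A1] * (c : {mpoly k[2]}))@_e = 0.
  by apply/eqP; apply: contra_notT n1; apply: toric_gr_coef_shift gc.
by rewrite !subr0 => /eqP; rewrite oner_eq0.
Qed.

Lemma scaleX_eq0 (i : 'I_n) (u : T) : 'X_i *: u = 0 -> u = 0.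
Proof.
rewrite scaleX => h; apply/mpolyP => m; rewrite mcoeff0.
have := congr1 (mcoeff (gen_exp d a i + m)%MM) h.
by rewrite mcoeffXM lem_addr addmC addmK mcoeff0.
Qed.

Lemma toric_gr_divX (i : 'I_n) j (u : T) : GT j u ->
  (forall e, (u : {mpoly k[2]})@_e != 0 -> exists2 f, S f & e = (gen_exp d a i + f)%MM) ->
  exists2 w : T, GT (j - 1) w & u = 'X_i *: w.
Proof.
move=> gu hu; have [w hw] := ex_divX (gen_exp d a i) u; exists w.
  move=> m; rewrite hw => um; have [f sf /eqP] := hu _ um.
  rewrite addmC eqm_add2l => /eqP em; split; first by rewrite em.
  by apply: (mdeg_shift (i := i)); rewrite addmC; case: (gu _ um).
rewrite scaleX; apply/mpolyP => e; rewrite mcoeffXM.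
case: ifPn => [le|nle]; first by rewrite hw submK.
by apply/eqP; apply: contraNT nle => /hu[f _ ->]; apply: lem_addr.
Qed.

(** A cycle is a pair [(u, v)] with [x_0 u + x_(n-1) v = 0], which amounts to the
    common value [x_0 u = - x_(n-1) v] in [x_0 M] and [x_(n-1) M]; it bounds when
    this value lies in [x_0 x_(n-1) M].  On monomials, the classes are thus the
    points [e] with [e - a_0] and [e - a_(n-1)] in the semigroup but not
    [e - a_0 - a_(n-1)]. *)
Lemma exceptional_kos j : ~ kos_acyclic GT ends 1 j <->
  exists2 e, exceptional e & (mdeg e)%:Z = j * d%:Z.
Proof.
rewrite kos_acyclic1_pair; split=> [nac|[e [se [f0 s0 e0] [f1 s1 e1] n01] de] h].
  apply: NNPP => nex; apply: nac => u v gu gv uv0.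
  have hv e : (v : {mpoly k[2]})@_e != 0 -> exists2 f, S f & e = (A0 + f)%MM.
    move=> ve; have [se de] := gv _ ve.
    have := congr1 (mcoeff (A1 + e)%MM) uv0; rewrite !scaleX mcoeff0 mcoeffD.
    rewrite [X in _ + X = 0]mcoeffXM lem_addr [(A1 + e)%MM]addmC addmK => /eqP.
    rewrite addr_eq0 => /eqP eu.
    have [f sf ef] : exists2 f, S f & (e + A1)%MM = (A0 + f)%MM.
      by apply: toric_gr_coef_shift gu _; rewrite eu oppr_eq0.
    apply: NNPP => nf; apply: nex; exists (e + A1)%MM.
      split; first by apply: in_sgpD => //; apply: in_sgp_gen.
      - by exists f.
      - by exists e => //; rewrite addmC.
      move=> [g sg eg]; apply: nf; exists g => //.
      by apply: (@addIm _ A1); rewrite eg -addmA [(A1 + g)%MM]addmC addmA.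
    by rewrite mdegD mdeg_gen_exp PoszD de; ring.
  have [w gw ew] := toric_gr_divX gv hv; exists w => //; split=> //.
  move: uv0; rewrite ew scalerA mulrC -scalerA -scalerDr => /scaleX_eq0/eqP.
  by rewrite addr_eq0 => /eqP.
have [|||w gw [_ ew]] := h (- 'X_[f0]) 'X_[f1].
- have gf : GT (j - 1) 'X_[f0].
    by apply: toric_grX => //; apply: (mdeg_shift (i := i0)); rewrite -e0.
  by have := toric_grP (c := -1) gf (@toric_gr0 k n d a (j - 1)); rewrite scaleN1r addr0.
- apply: toric_grX => //; apply: (mdeg_shift (i := i1)); by rewrite -e1.
- by rewrite !scaleX mulrN -!mpolyXD -e0 -e1 addNr.
have := congr1 (mcoeff f1) ew; rewrite scaleX mcoeffX eqxx => wf.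
have [|g sg eg] := toric_gr_coef_shift (i := i0) (e := f1) gw.
  by rewrite -wf oner_eq0.
by apply: n01; exists g => //; rewrite e1 eg addmA [(A1 + A0)%MM]addmC.
Qed.

End BaseCase.

(** * Maxima of sets of integers *)

Lemma is_max_union (P Q U : int -> Prop) mP mQ :
  (forall z, U z <-> P z \/ Q z) -> is_max P mP -> is_max Q mQ ->
  is_max U (emax mP mQ).
Proof.
move=> hU; case: mP => [x|] hP; case: mQ => [y|] hQ /=.
- case: hP hQ => Px maxP [Qy maxQ]; split.
    by apply/hU; rewrite maxEle; case: ifP; [right | left].
  by move=> z /hU[/maxP|/maxQ] h; rewrite le_max h ?orbT.
- case: hP => Px maxP; split; first by apply/hU; left.
  by move=> z /hU[/maxP|/hQ].
- case: hQ => Qy maxQ; split; first by apply/hU; right.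
  by move=> z /hU[/hP|/maxQ].
by move=> z /hU[/hP|/hQ].
Qed.

Lemma is_max_ext (P Q : int -> Prop) m :
  (forall z, P z <-> Q z) -> is_max P m -> is_max Q m.
Proof.
move=> hPQ; case: m => [x [Px maxP]|nP] /=.
  by split=> [|z /hPQ/maxP//]; apply/hPQ.
by move=> z /hPQ/nP.
Qed.

Lemma ex_is_max (P : int -> Prop) (B : nat) :
  (forall z, P z -> 0 <= z <= B%:Z) -> exists m, is_max P m.
Proof.
elim: B P => [|B IH] P hP.
  have [P0|nP0] := classic (P 0).
    by exists (Some 0); split=> // z /hP; lia.
  by exists None => z Pz; apply: nP0; have -> : 0 = z by have := hP z Pz; lia.
have [PB|nPB] := classic (P B.+1%:Z).
  by exists (Some B.+1%:Z); split=> // z /hP; lia.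
apply: IH => z Pz; have := hP z Pz; have [ez|] := eqVneq z B.+1%:Z; last by lia.
by case: nPB; rewrite -ez.
Qed.

(** * Finiteness of the Apery and exceptional sets *)

Section Points.
Variables (n d : nat) (a : nat -> nat).
Implicit Types (e f g : 'X_{1..2}) (p : int * int).

(** The translation between exponents of monomials in two variables, for which
    subtraction is truncated, and points of the plane with integer
    coordinates. *)
Definition exp_point e : int * int := ((e ord0)%:Z, (e ord_max)%:Z).

Lemma exp_pointD e f : exp_point (e + f)%MM = exp_point e + exp_point f.
Proof. by rewrite /exp_point !mnmDE. Qed.

Lemma exp_point_inj : injective exp_point.
Proof.
move=> e f [e0 e1]; apply/mnmP; case=> [[|[|//]]] h.
  by rewrite (_ : Ordinal h = ord0) //; apply: val_inj.
by rewrite (_ : Ordinal h = ord_max) //; apply: val_inj.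
Qed.

Lemma avecE (i : 'I_n) : avec d a i = exp_point (gen_exp d a i).
Proof. by rewrite /exp_point !mnmE. Qed.

Lemma exp_point_toric (m : 'X_{1..n}) :
  exp_point (toric_exp d a m) = \sum_(i < n) avec d a i *+ m i.
Proof.
have -> : exp_point (toric_exp d a m) = \sum_(i < n) exp_point (gen_exp d a i *+ m i).
  apply: (big_morph exp_point); first exact: exp_pointD.
  by rewrite /exp_point !mnm0E.
apply: eq_bigr => i _; rewrite avecE; elim: (m i) => [|c IH].
  by rewrite mulm0n mulr0n /exp_point !mnm0E.
by rewrite mulmS exp_pointD IH mulrS.
Qed.

Lemma semigroupP p : semigroup n d a p <-> exists2 e, in_sgp n d a e & p = exp_point e.
Proof.
split=> [[c ->]|[_ [m ->] ->]]; last by exists m; rewrite exp_point_toric.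
exists (toric_exp d a [multinom c i | i < n]); first by eexists.
by rewrite exp_point_toric; apply: eq_bigr => i _; rewrite mnmE.
Qed.

Lemma semigroup_pointP e : semigroup n d a (exp_point e) <-> in_sgp n d a e.
Proof.
by rewrite semigroupP; split=> [[f sf /exp_point_inj->]//|se]; exists e.
Qed.

Lemma semigroup_subP e f : semigroup n d a (exp_point e - exp_point f) <->
  exists2 g, in_sgp n d a g & e = (f + g)%MM.
Proof.
rewrite semigroupP; split=> [[g sg efg]|[g sg ->]]; exists g => //.
  by apply: exp_point_inj; rewrite exp_pointD -efg addrC subrK.
by rewrite exp_pointD addrAC subrr add0r.
Qed.

Lemma Lline_point s e : Lline d s (exp_point e) <-> mdeg e = (s * d)%N.
Proof.
rewrite mdeg2; split=> [[_ _]|h]; first by rewrite /= -PoszD => -[].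
by split; rewrite //= -PoszD h.
Qed.

Hypothesis ha_le : forall i : 'I_n, (a i <= d)%N.
Hypothesis d_gt0 : (0 < d)%N.
Variables i0 i1 : 'I_n.
Hypothesis i0_val : i0 = 0%N :> nat.
Hypothesis i1_val : i1 = n.-1 :> nat.
Local Notation A0 := (gen_exp d a i0).
Local Notation A1 := (gen_exp d a i1).
Local Notation S := (in_sgp n d a).

Lemma avec_first : avec d a 0 = exp_point A0.
Proof. by rewrite -avecE i0_val. Qed.

Lemma avec_last : avec d a n.-1 = exp_point A1.
Proof. by rewrite -avecE i1_val. Qed.

Lemma AP_point p : AP n d a p <-> exists2 e, apery d a i0 i1 e & p = exp_point e.
Proof.
rewrite /AP avec_first avec_last; split.
  move=> [/semigroupP[e se ->]].
  by rewrite !semigroup_subP => n0 n1; exists e.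
move=> [e [se n0 n1] ->]; split; first exact/semigroup_pointP.
  by rewrite semigroup_subP.
by rewrite semigroup_subP.
Qed.

Lemma Eset_point p : Eset n d a p <-> exists2 e, exceptional d a i0 i1 e & p = exp_point e.
Proof.
rewrite /Eset avec_first avec_last; split.
  move=> [/semigroupP[e se ->]].
  by rewrite -addrA -opprD -exp_pointD !semigroup_subP => h0 h1 n01; exists e.
move=> [e [se h0 h1 n01] ->].
rewrite -addrA -opprD -exp_pointD; split; first exact/semigroup_pointP.
- exact/semigroup_subP.
- exact/semigroup_subP.
by rewrite semigroup_subP.
Qed.

Lemma AP_levelE z : (exists s : nat, z = s%:Z /\ exists p, AP n d a p /\ Lline d s p) <->
  exists2 e, apery d a i0 i1 e & (mdeg e)%:Z = z * d%:Z.
Proof.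
split=> [[s [-> [p [/AP_point[e ae ->] /Lline_point de]]]]|[e ae de]].
  by exists e => //; rewrite de PoszM.
have z0 : 0 <= z by nia.
exists `|z|%N; split; first by rewrite gez0_abs.
exists (exp_point e); split; first by apply/AP_point; exists e.
by apply/Lline_point; nia.
Qed.

(** A nonnegative [z] is automatic on the right, since an exceptional
    exponent has at least the degree of [a_0]. *)
Lemma Eset_levelE z :
  (exists s : nat, z = s%:Z /\ exists p, Eset n d a p /\ Lline d s.+1 p) <->
  exists2 e, exceptional d a i0 i1 e & (mdeg e)%:Z = (z + 1) * d%:Z.
Proof.
split=> [[s [-> [p [/Eset_point[e ae ->] /Lline_point de]]]]|[e ae de]].
  by exists e => //; rewrite de PoszM -addn1 PoszD.
have de0 : (d <= mdeg e)%N.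
  by have [_ [f _ ->] _ _] := ae; rewrite mdegD mdeg_gen_exp // leq_addr.
have z0 : 0 <= z by nia.
exists `|z|%N; split; first by rewrite gez0_abs.
exists (exp_point e); split; first by apply/Eset_point; exists e.
by apply/Lline_point; nia.
Qed.

Hypothesis ha0 : a i0 = 0%N.
Hypothesis ha1 : a i1 = d.

(** The relation [d a_i = (d - a_i) a_0 + a_i a_(n-1)], by which multiplicities
    of at least [d] can be traded for the two end generators. *)
Lemma gen_exp_muld (i : 'I_n) :
  (gen_exp d a i *+ d = A0 *+ (d - a i) + A1 *+ a i)%MM.
Proof.
apply/mnmP => t; rewrite mnmDE !mulmnE !mnmE ha0 ha1 subn0 subnn.
by case: ifP => _; rewrite ?mul0n ?add0n ?addn0 mulnC.
Qed.

Lemma in_sgpMn e c : S e -> S (e *+ c)%MM.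
Proof.
move=> se; elim: c => [|c IH]; first by rewrite mulm0n; apply: in_sgp0.
by rewrite mulmS; apply: in_sgpD.
Qed.

Lemma toric_expMn (m : 'X_{1..n}) c :
  toric_exp d a (m *+ c)%MM = (toric_exp d a m *+ c)%MM.
Proof.
elim: c => [|c IH]; last by rewrite !mulmS toric_expD IH.
by rewrite !mulm0n /toric_exp big1 // => t _; rewrite mnm0E mulm0n.
Qed.

Lemma toric_exp_reduce (m : 'X_{1..n}) i : (d <= m i)%N ->
  exists2 e, S e & toric_exp d a m = (A0 *+ (d - a i) + A1 *+ a i + e)%MM.
Proof.
move=> dm; exists (toric_exp d a (m - U_(i) *+ d)); first by eexists.
rewrite -gen_exp_muld -(toric_exp1 d a i).
rewrite -toric_expMn -toric_expD addmC submK //; apply/mnm_lepP => t.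
by rewrite mulmnE mnm1E; case: eqP => [<-|//]; rewrite mul1n.
Qed.

Lemma toric_exp_reduce0 (m : 'X_{1..n}) i : (d <= m i)%N -> (a i < d)%N ->
  exists2 e, S e & toric_exp d a m = (A0 + e)%MM.
Proof.
move=> dm; rewrite -subn_gt0 => ad; have [e se ->] := toric_exp_reduce dm.
exists (A0 *+ (d - a i).-1 + A1 *+ a i + e)%MM.
  by apply: in_sgpD => //; apply: in_sgpD; apply: in_sgpMn; apply: in_sgp_gen.
by rewrite -{1}(prednK ad) mulmS -!addmA.
Qed.

Lemma toric_exp_reduce1 (m : 'X_{1..n}) i : (d <= m i)%N -> (0 < a i)%N ->
  exists2 e, S e & toric_exp d a m = (A1 + e)%MM.
Proof.
move=> dm ad; have [e se ->] := toric_exp_reduce dm.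
exists (A0 *+ (d - a i) + A1 *+ (a i).-1 + e)%MM.
  by apply: in_sgpD => //; apply: in_sgpD; apply: in_sgpMn; apply: in_sgp_gen.
by rewrite -{2}(prednK ad) mulmS; apply/mnmP => t; rewrite !mnmDE; lia.
Qed.

(** In an Apery element no generator occurs [d] times or more, by
    [gen_exp_muld]. *)
Lemma apery_bound e : apery d a i0 i1 e -> (mdeg e <= n * d * d)%N.
Proof.
move=> [[m ->] n0 n1]; rewrite (mdeg_toric_exp ha_le) leq_mul2r; apply/orP; right.
have -> : (n * d = \sum_(i < n) d)%N by rewrite sum_nat_const card_ord.
rewrite mdegE; apply: leq_sum => i _.
rewrite leqNgt; apply/negP => /ltnW dm.
have [a0|] := posnP (a i); last by move=> /(toric_exp_reduce1 dm).
by apply: n0; apply: (toric_exp_reduce0 dm); rewrite a0.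
Qed.

(** Write [e = a_0 + f].  In [f], a generator with [a_i > 0] occurs less than [d]
    times, as otherwise [e - a_0 - a_(n-1)] would be in the semigroup; this
    bounds the first coordinate of [e], to which [a_0] does not contribute.
    The second one is bounded symmetrically. *)
Lemma exceptional_bound e : exceptional d a i0 i1 e -> (mdeg e <= 2 * (n * (d * d)))%N.
Proof.
move=> [se [_ [m0 ->] e0] [_ [m1 ->] e1] n01].
have sumdd : (n * (d * d) = \sum_(i < n) d * d)%N.
  by rewrite sum_nat_const card_ord.
have b0 : (e ord0 <= n * (d * d))%N.
  rewrite e0 mnmDE [gen_exp _ _ _ _]mnmE ha0 add0n toric_exp0 sumdd.
  apply: leq_sum => i _.
  have [->|ai] := posnP (a i); first by rewrite mul0n.
  apply: leq_mul; first exact: ha_le.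
  rewrite leqNgt; apply/negP => /ltnW dm; apply: n01.
  have [g sg eg] := toric_exp_reduce1 dm ai.
  by exists g; rewrite // e0 eg addmA.
have b1 : (e ord_max <= n * (d * d))%N.
  rewrite e1 mnmDE [gen_exp _ _ _ _]mnmE ha1 subnn add0n toric_exp_max sumdd.
  apply: leq_sum => i _.
  have [da|ai] := leqP d (a i); first by rewrite (eqP da) mul0n.
  apply: leq_mul; first exact: leq_subr.
  rewrite leqNgt; apply/negP => /ltnW dm; apply: n01.
  have [g sg eg] := toric_exp_reduce0 dm ai.
  by exists g; rewrite // e1 eg addmA [(A1 + A0)%MM]addmC.
by rewrite mdeg2 mul2n -addnn leq_add.
Qed.

Lemma ex_mAP : exists m, is_mAP n d a m.
Proof.
apply: (@ex_is_max _ (n * d * d)%N) => z /AP_levelE[e /apery_bound]; nia.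
Qed.

Lemma ex_mE : exists m, is_mE n d a m.
Proof.
apply: (@ex_is_max _ (2 * (n * (d * d)))%N) => z hz.
have [s [zs _]] := hz; move/Eset_levelE: hz => [e /exceptional_bound]; nia.
Qed.

End Points.

(** * The regularity of the curve *)

Section CurveRegularity.
Variables (k : fieldType) (n d : nat) (a : nat -> nat).
Local Notation R := {mpoly k[n]}.
Local Notation C := (curve_ring k n d a).
Local Notation T := (toric_module k n d a).
Local Notation GT := (toric_gr (k := k) n d a : int -> T -> Prop).
Hypothesis ha_le : forall i : 'I_n, (a i <= d)%N.
Hypothesis d_gt0 : (0 < d)%N.

Definition curve_aug (v : 'rV[R]_1) : C := curve_proj d a (v 0 0).

Lemma curve_aug_linear : linear curve_aug.
Proof. by move=> p u v; rewrite /curve_aug !mxE curve_projP. Qed.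

HB.instance Definition _ := GRing.isLinear.Build R 'rV[R]_1 C *:%R curve_aug
  curve_aug_linear.

Lemma curve_aug_onto x : exists v, curve_aug v = x.
Proof. by exists (const_mx (repr x)); rewrite /curve_aug mxE curve_projK. Qed.

Lemma curve_aug_graded t : curve_gr 0 (curve_aug (delta_mx 0 t)).
Proof.
exists 1; rewrite /curve_aug mxE (ord1 t) !eqxx; split=> //.
exact: dhomog1.
Qed.

Lemma curve_aug_ker_min v : curve_aug v = 0 -> forall t, (v 0 t)@_0%MM = 0.
Proof.
move=> /curve_toric_eq0; rewrite curve_toric_proj => h t.
by rewrite (ord1 t); apply: toric_map_mcoeff0 h.
Qed.

Variable s : seq 'I_n.
Hypothesis s_uniq : uniq s.
Hypothesis s_all : forall i : 'I_n, i \in s.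

(** The resolution starts with the free module of rank one; its first syzygies
    are the toric ideal. *)
Lemma ex_curve_resolution c :
  (forall i j, c < j - i -> kos_acyclic GT (vars k s) i j) ->
  exists F : free_complex C, minimal_graded_resolution (@curve_gr k n d a) F.
Proof.
move=> hc.
pose K (v : 'rV[R]_1) := toric_aug curve_aug v = 0.
have Ksub : homog_submodule (fun _ : 'I_1 => 0) K.
  split=> [|p u v u0 v0|j v v0]; first exact: linear0.
    by rewrite /K linearP /= u0 v0 scaler0 addr0.
  by rewrite /K (toric_aug_comp ha_le d_gt0 curve_aug_graded) v0 hcomp0.
have Kmin v : K v -> forall t, (v 0 t)@_0%MM = 0.
  by move=> /toric_aug_ker; apply: curve_aug_ker_min.
have Kreg : exists c', forall i j, c' < j - i ->
    kos_acyclic (sub_gr (fun _ : 'I_1 => 0) K) (vars k s) i j.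
  exists (c + 1) => i j cij.
  have [i0|i0] := boolP (i < 0).
    by apply: kos_acyclic_lt0 => //; apply: sub_gr_graded Ksub _.
  have onto := toric_aug_onto ha_le d_gt0 curve_aug_onto curve_aug_graded.
  have graded := toric_aug_graded ha_le d_gt0 curve_aug_graded.
  have acyc i' j' : 1 <= i' ->
      kos_acyclic (free_gr (fun _ : 'I_1 => 0)) (vars k s) i' j'.
    exact: free_kos_acyclic.
  have kmin j' v : free_gr (fun _ : 'I_1 => 0) j' v -> toric_aug curve_aug v = 0 ->
      lincomb (free_gr (fun _ : 'I_1 => 0)) (vars k s) j' v.
    by move=> gv v0; apply: lincomb_mcoeff0 => //; apply: Kmin.
  have i0' : 0 <= i by lia.
  have := kos_acyclic_shift (free_graded k (fun _ : 'I_1 => 0) s) onto graded acyc kmin j i0'.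
  move=> [h _]; apply: h; apply: hc; lia.
apply: (ex_minimal_resolution s_uniq s_all (S0 := SyzygyStage Ksub Kmin Kreg)
  (aug := curve_aug)).
- exact: curve_aug_onto.
- exact: curve_aug_graded.
- by move=> v; apply: toric_aug_ker.
Qed.

(** Valid for the Betti numbers of an arbitrary minimal resolution, which gives
    their independence of the choice at the same time. *)
Lemma curve_betti_slopes beta z : is_graded_betti (@curve_gr k n d a) beta ->
  kos_slopes GT (vars k s) z <->
  exists (i : nat) (j : int), beta i j <> 0%N /\ z = j - i%:Z.
Proof.
move=> [F [F_min hbeta]].
have bettiP i j : kos_acyclic GT (vars k s) i%:Z j <-> beta i j = 0%N.
  rewrite (betti_kos_acyclic F_min (phi := toric_aug (res_aug F)) s_uniq s_all).
  - rewrite hbeta; split=> [h|/eqP].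
      by apply/eqP; rewrite cards_eq0; apply/eqP/setP => t; rewrite !inE (negPf (h t)).
    rewrite cards_eq0 => /eqP/setP h t; have := h t.
    by rewrite !inE => ->.
  - exact: toric_aug_ker.
  - exact: (toric_aug_onto ha_le d_gt0 (res_aug_surj F_min) (res_aug_graded F_min)).
  - exact: (toric_aug_graded ha_le d_gt0 (res_aug_graded F_min)).
split=> [[i [j [nij ->]]]|[i [j [bij ->]]]].
  have [i0|i0] := boolP (i < 0).
    by case: nij; apply: kos_acyclic_lt0 => //; apply: toric_module_graded.
  exists `|i|%N, j; rewrite gez0_abs; last by lia.
  split=> // b0; apply: nij; have -> : i = `|i|%N by lia.
  exact/bettiP.
by exists i%:Z, j; split=> // /bettiP.
Qed.

Lemma curve_regularity r : is_max (kos_slopes GT (vars k s)) r ->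
  is_regularity (@curve_gr k n d a) r.
Proof.
move=> hr; split; last first.
  by move=> beta hbeta; apply: is_max_ext hr => z; apply: curve_betti_slopes.
have [c hc] : exists c, forall i j, c < j - i -> kos_acyclic GT (vars k s) i j.
  case: r hr => [r|] /= hr; [exists r | exists 0] => i j cij; apply: NNPP => nij.
    have : j - i <= r by apply: hr.2; exists i, j.
    by lia.
  by apply: (hr (j - i)); exists i, j.
have [F F_min] := ex_curve_resolution hc.
by exists (fun i j => #|[set t : 'I_(res_rank F i) | res_deg t == j]|), F.
Qed.

End CurveRegularity.

Section EndVariables.
Variables (k : fieldType) (n d : nat) (a : nat -> nat).
Local Notation R := {mpoly k[n]}.
Local Notation T := (toric_module k n d a).
Local Notation GT := (toric_gr (k := k) n d a : int -> T -> Prop).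
Hypothesis ha_le : forall i : 'I_n, (a i <= d)%N.
Hypothesis d_gt0 : (0 < d)%N.
Variables i0 i1 : 'I_n.
Hypothesis i0_val : i0 = 0%N :> nat.
Hypothesis i1_val : i1 = n.-1 :> nat.

Lemma end_slopes z : kos_slopes GT (vars k [:: i0; i1]) z <->
  (exists s : nat, z = s%:Z /\ exists p, AP n d a p /\ Lline d s p) \/
  (exists s : nat, z = s%:Z /\ exists p, Eset n d a p /\ Lline d s.+1 p).
Proof.
rewrite (AP_levelE a d_gt0 i0_val i1_val).
rewrite (Eset_levelE ha_le d_gt0 i0_val i1_val).
rewrite -(apery_kos k ha_le d_gt0) -(exceptional_kos k ha_le).
split=> [[i [j [nij ->]]]|[nij|nij]]; last 2 first.
- by exists 0, z; rewrite subr0.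
- by exists 1, (z + 1); rewrite addrK.
have gT := toric_module_graded k ha_le d_gt0 [:: i0; i1].
have [ei|n0] := eqVneq i 0; first by left; rewrite ei subr0 -ei.
have [ei|n1] := eqVneq i 1; first by right; rewrite ei subrK -ei.
case: nij; have [ei|n2] := eqVneq i 2.
  by rewrite ei; apply: kos_acyclic2_pair => w; apply: scaleX_eq0.
have [ilt|ige] := boolP (i < 0); first exact: kos_acyclic_lt0.
by apply: kos_acyclic_gt_size => //=; lia.
Qed.

Lemma is_max_end_slopes mE mAP : is_mE n d a mE -> is_mAP n d a mAP ->
  is_max (kos_slopes GT (vars k [:: i0; i1])) (emax mE mAP).
Proof.
move=> hE hAP; apply: is_max_union hE hAP => z.
by rewrite end_slopes; tauto.
Qed.

End EndVariables.

Theorem theorem3p7 (k : fieldType) (n d : nat) (a : nat -> nat)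
  (hk : infinite_field k)
  (hn : (4 <= n)%N)
  (ha0 : a 0%N = 0%N)
  (ha_lt : forall i j : nat, (i < j)%N -> (j < n)%N -> (a i < a j)%N)
  (had : a n.-1 = d)
  (ha_gcd : \big[gcdn/0%N]_(1 <= i < n) a i = 1%N) :
  exists mE mAP : option int,
    [/\ is_mE n d a mE,
        is_mAP n d a mAP
      & is_regularity (@curve_gr k n d a) (emax mE mAP)].
Proof.
have ha_le (i : 'I_n) : (a i <= d)%N.
  have [->|ni] := eqVneq (i : nat) n.-1; first by rewrite had.
  by rewrite -had ltnW //; apply: ha_lt; have := ltn_ord i; lia.
have d_gt0 : (0 < d)%N by rewrite -had -ha0; apply: ha_lt; lia.
have n_gt0 : (0 < n)%N by lia.
have n1_lt : (n.-1 < n)%N by lia.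
pose i0 := Ordinal n_gt0; pose i1 := Ordinal n1_lt.
have [mE hE] := ex_mE ha_le d_gt0 (i0 := i0) (i1 := i1) erefl erefl ha0 had.
have [mAP hAP] := ex_mAP ha_le d_gt0 (i0 := i0) (i1 := i1) erefl erefl ha0 had.
exists mE, mAP; split=> //.
(* The two end variables come last, so that the Koszul complex of all the
   variables is built from theirs by cones. *)
pose others := [seq i <- enum 'I_n | i \notin [:: i0; i1]].
have s_uniq : uniq (others ++ [:: i0; i1]).
  rewrite cat_uniq filter_uniq ?enum_uniq //= orbF !inE !mem_filter !inE !eqxx.
  by rewrite orbT /= -val_eqE /=; lia.
have s_all (i : 'I_n) : i \in others ++ [:: i0; i1].
  by rewrite mem_cat mem_filter mem_enum andbT orNb.
apply: (curve_regularity ha_le d_gt0 s_uniq s_all).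
rewrite /vars map_cat; apply: is_max_kos_slopes_cat.
  by rewrite -map_cat; apply: toric_module_graded.
exact: (is_max_end_slopes k ha_le d_gt0 (i0 := i0) (i1 := i1)).
Qed.
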